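(* Let $\Gamma$ be a connected bichromatic graph that is locally like the Weyl graph $\mathbb{W}(F_4)$. Assume that at least one of the following conditions holds: (a) $|\Gamma|=24$; (b) $\Gamma$ is tightly connected; (c) $\Gamma$ has diameter $2$; (d) $\mu=3$, i.e. $\mu(x,y)=3$ for all vertices $x,y$ of $\Gamma$ of the same type (both short or both long) at distance $2$. Then $\Gamma$ is isomorphic, as a bichromatic graph, to $\mathbb{W}(F_4)$ or to its twisted copy $\mathbb{W}(F_4)'$. In particular, $\operatorname{Aut}(\Gamma)\cong W(F_4)/Z$, where $Z$ denotes the center of the Weyl group $W(F_4)$.
   Context: All graphs are simple and undirected; $|\Gamma|$ is the number of vertices of $\Gamma$. A bichromatic graph is a graph in which each vertex is designated either short or long (adjacent vertices may have the same type); isomorphisms and automorphisms of bichromatic graphs preserve the type, and induced subgraphs inherit it. For a vertex $x$, $x^\perp$ is the set of neighbors of $x$, and the local graph at $x$ is the induced subgraph on $x^\perp$; for a set $X$ of vertices, $X^\perp=\bigcap_{x\in X}x^\perp$. $W(F_4)$ is the Weyl group of the root system of type $F_4$. The Weyl graph $\mathbb{W}(F_4)$ is the bichromatic graph whose vertices are the $24$ reflections of $W(F_4)$, two distinct reflections being adjacent if and only if they commute, where reflections in short (respectively long) roots are the short (respectively long) vertices. All its local graphs at short vertices are isomorphic to $\mathbb{W}(B_3)$ and all its local graphs at long vertices are isomorphic to $\mathbb{W}(C_3)$. Here $\mathbb{W}(B_3)$ is the bichromatic graph with vertices $y_{i,j}$, $1\leqslant i,j\leqslant 3$, where the $y_{i,i}$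 are short and the $y_{i,j}$ with $i\neq j$ are long, and distinct $y_{i,j},y_{k,l}$ are adjacent if and only if $\{i,j\}\cap\{k,l\}=\emptyset$ or $(k,l)=(j,i)$; $\mathbb{W}(C_3)$ is obtained from $\mathbb{W}(B_3)$ by exchanging short and long. A bichromatic graph $\Gamma$ is locally like $\mathbb{W}(F_4)$ if the local graph at every short vertex is isomorphic (as a bichromatic graph) to $\mathbb{W}(B_3)$ and the local graph at every long vertex is isomorphic to $\mathbb{W}(C_3)$. A short (respectively long) component of a bichromatic graph is a connected component of the induced subgraph on its short (respectively long) vertices. A bichromatic graph is tightly connected if every long vertex has a neighbor in every short component and every short vertex has a neighbor in every long component. For $\Gamma$ locally like $\mathbb{W}(F_4)$ and vertices $x,y$ of the same type at distance $2$, the set $\{x,y\}^\perp$ consists of $\mu(x,y)\in\{1,2,3\}$ pairwise non-adjacent vertices of the other type; this defines $\mu(x,y)=|\{x,y\}^\perp|$. Twisted copy: in any bichromatic graph $\Gamma$ locally like $\mathbb{W}(F_4)$, the induced subgraph on the short vertices, and likewise on the long vertices, is a disjoint union of $4$-cliques (complete graphs on $4$ vertices, with no edges between different ones). A short such $4$-clique $X$ and a long such $4$-clique $Y$ are strongly connected if every vertex of $X$ has a neighbor in $Y$ and every vertex of $Y$ has a neighbor in $X$. In this case one can write $X=\{x_1,x_2,x_3,x_4\}$ and $Y=\{y_1,y_2,y_3,y_4\}$ such that the adjacencies between $X$ and $Y$ are exactly: each of $x_1,x_2$ is adjacent to each of $y_1,y_2$, and each of $x_3,x_4$ is adjacent to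 each of $y_3,y_4$. Replacing these adjacencies by: each of $x_1,x_2$ is adjacent to each of $y_3,y_4$, and each of $x_3,x_4$ is adjacent to each of $y_1,y_2$ (all other adjacencies unchanged) gives a bichromatic graph, again locally like $\mathbb{W}(F_4)$, called a twisted copy of $\Gamma$. For $\Gamma=\mathbb{W}(F_4)$ all twisted copies are isomorphic, and the resulting graph is denoted $\mathbb{W}(F_4)'$. *)

(* Defs.v *)
From HB Require Import structures.
From mathcomp Require Import all_boot all_order all_algebra.
From mathcomp Require Import all_fingroup all_solvable.
From mathcomp Require Import boolp classical_sets functions cardinality.
From mathcomp Require Import ring.

Set Implicit Arguments.
Unset Strict Implicit.
Unset Printing Implicit Defensive.

Import Order.TTheory GRing.Theory Num.Theory.

Local Open Scope classical_set_scope.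

(* The vertices that are not short are long; the vertex set may be infinite. *)
Record bigraph := BiGraph {
  vertex :> Type;
  adj : rel vertex;
  short : pred vertex;
  adj_sym : symmetric adj;
  adj_irr : irreflexive adj }.

Arguments adj {b} _ _.
Arguments short {b} _.

Section Bigraph.
Variable G : bigraph.
Implicit Types (x y : G) (X : set G).

Definition long x := ~~ short x.

Definition is_iso (H : bigraph) (f : G -> H) : Prop :=
  [/\ bijective f, forall x y, adj (f x) (f y) = adj x y
    & forall x, short (f x) = short x].

Definition bigraph_iso (H : bigraph) : Prop := exists f : G -> H, is_iso f.

Definition perp X : set G := [set y | forall x, X x -> adj x y].

Lemma induced_sym X : symmetric (fun u v : X => adj (val u) (val v)).
Proof. by move=> u v; rewrite adj_sym. Qed.

Lemma induced_irr X : irreflexive (fun u v : X => adj (val u) (val v)).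
Proof. by move=> u; rewrite adj_irr. Qed.

Definition induced X : bigraph :=
  BiGraph (fun u : X => short (val u)) (@induced_sym X) (@induced_irr X).

Definition local_graph x : bigraph := induced (perp [set x]).

Definition walk_of_length (n : nat) x y : Prop :=
  exists p : seq G, [/\ path adj x p, last x p = y & size p = n].

Definition at_distance (n : nat) x y : Prop :=
  walk_of_length n x y /\ (forall m, m < n -> ~ walk_of_length m x y).

Definition linked x y : Prop := exists n, walk_of_length n x y.

(* The graph without vertices is not connected. *)
Definition connected : Prop := inhabited G /\ forall x y, linked x y.

Definition has_diameter (d : nat) : Prop :=
  (forall x y, exists2 n, n <= d & at_distance n x y) /\
  (exists x y, at_distance d x y).

Definition is_component (C : set G) : Prop :=
  exists x, C = [set y | linked x y].

Definition mu_is x y (n : nat) : Prop := (perp [set x; y] #= `I_n)%card.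

End Bigraph.

Definition short_graph (G : bigraph) : bigraph := induced [set x : G | short x].
Definition long_graph (G : bigraph) : bigraph := induced [set x : G | long x].

Definition tightly_connected (G : bigraph) : Prop :=
  (forall x : G, long x -> forall C : set (short_graph G), is_component C ->
     exists2 y, C y & adj x (val y)) /\
  (forall x : G, short x -> forall C : set (long_graph G), is_component C ->
     exists2 y, C y & adj x (val y)).

Record bigraph_aut (G : bigraph) := Aut { aut_fun :> G -> G; aut_is_iso : is_iso aut_fun }.

Section AutGroup.
Variable G : bigraph.
Implicit Types f g h : bigraph_aut G.

Lemma aut_inj f g : aut_fun f = aut_fun g -> f = g.
Proof.
by case: f g => f Hf [g Hg] /= E; case: _ / E Hg => Hg; congr Aut; exact: Prop_irrelevance.
Qed.

Lemma aut_one_iso : is_iso (@id G).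
Proof. by split=> //; exists id. Qed.

Lemma aut_mul_iso f g : is_iso (f \o g).
Proof.
case: f g => f [fb fa fs] [g [gb ga gs]] /=; split=> [|x y|x] /=.
- exact: bij_comp.
- by rewrite fa ga.
- by rewrite fs gs.
Qed.

Lemma aut_inv_subproof f : exists g : bigraph_aut G, cancel f g /\ cancel g f.
Proof.
case: f => f [[g fK gK] fa fs].
have gi : is_iso g.
  split=> [|x y|x]; first by exists f.
  - by rewrite -fa !gK.
  - by rewrite -fs gK.
by exists (Aut gi).
Qed.

Definition aut_one := Aut aut_one_iso.
Definition aut_mul f g := Aut (aut_mul_iso f g).
Definition aut_inv f := projT1 (cid (aut_inv_subproof f)).

Lemma aut_mulA : associative aut_mul.
Proof. by move=> f g h; apply: aut_inj. Qed.
Lemma aut_mul1 : left_id aut_one aut_mul.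
Proof. by move=> f; apply: aut_inj. Qed.
Lemma aut_1mul : right_id aut_one aut_mul.
Proof. by move=> f; apply: aut_inj. Qed.
Lemma aut_mulV : left_inverse aut_one aut_inv aut_mul.
Proof.
move=> f; apply: aut_inj; rewrite /aut_inv; case: cid => g [fK gK] /=.
by apply/funext => x /=; rewrite fK.
Qed.
Lemma aut_Vmul : right_inverse aut_one aut_inv aut_mul.
Proof.
move=> f; apply: aut_inj; rewrite /aut_inv; case: cid => g [fK gK] /=.
by apply/funext => x /=; rewrite gK.
Qed.

HB.instance Definition _ := gen_eqMixin (bigraph_aut G).
HB.instance Definition _ := gen_choiceMixin (bigraph_aut G).
HB.instance Definition _ := isGroup.Build (bigraph_aut G)
  aut_mulA aut_mul1 aut_1mul aut_mulV aut_Vmul.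

End AutGroup.

Definition group_isomorphic (gT : finGroupType) (H : {group gT}) (K : groupType)
  : Prop :=
  exists f : subg_of H -> K, bijective f /\ {morph f : a b / (a * b)%g}.

Section Twist.
Variables (G : bigraph) (x y : 'I_4 -> G).

Definition same_half : rel 'I_4 := fun i j => (i < 2) == (j < 2).

(* x and y enumerate a short and a long 4-clique which are components of the
   graphs of short and long vertices and are strongly connected, in the order
   in which the first (resp. last) two x's are adjacent to the first (resp.
   last) two y's. *)
Record twist_data : Prop := TwistData {
  twist_short : forall i, short (x i);
  twist_long : forall i, long (y i);
  twist_clique_x : forall i j, adj (x i) (x j) = (i != j);
  twist_clique_y : forall i j, adj (y i) (y j) = (i != j);
  twist_comp_x : forall i z, short z -> adj (x i) z -> exists j, z = x j;
  twist_comp_y : forall i z, long z -> adj (y i) z -> exists j, z = y j;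
  twist_adj_xy : forall i j, adj (x i) (y j) = same_half i j }.

Definition cross (r : rel 'I_4) (u v : G) : Prop :=
  exists i j, r i j /\ ((u = x i /\ v = y j) \/ (u = y j /\ v = x i)).

Definition twist_adj : rel G := fun u v =>
  `[< cross (fun i j => ~~ same_half i j) u v
      \/ (adj u v /\ ~ cross (fun _ _ => true) u v) >].

Lemma cross_sym r u v : cross r u v -> cross r v u.
Proof. by case=> i [j [rij [[-> ->]|[-> ->]]]]; exists i, j; split=> //; [right|left]. Qed.

Lemma twist_sym : symmetric twist_adj.
Proof.
suff H u v : twist_adj u v -> twist_adj v u by move=> u v; apply/idP/idP; apply: H.
move/asboolP=> H; apply/asboolP; case: H => [/cross_sym|[uv ncr]]; first by left.
by right; split=> [|/cross_sym//]; rewrite adj_sym.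
Qed.

Lemma twist_irr : twist_data -> irreflexive twist_adj.
Proof.
move=> D u; apply/negP => /asboolP[[i [j [_ H]]]|[]]; last by rewrite adj_irr.
have /eqP : short (x i) = short (y j) by case: H => -[<- <-].
by rewrite (twist_short D) (negbTE (twist_long D j)).
Qed.

Definition twisted_copy (D : twist_data) : bigraph :=
  BiGraph (@short G) twist_sym (twist_irr D).

End Twist.

Section B3.

Definition WB3_adj : rel ('I_3 * 'I_3) := fun p q =>
  (p != q) && ([disjoint [set p.1; p.2]%SET & [set q.1; q.2]%SET]
               || ((q.1 == p.2) && (q.2 == p.1))).

Lemma WB3_sym : symmetric WB3_adj.
Proof.
move=> p q; rewrite /WB3_adj eq_sym disjoint_sym.
by rewrite (eq_sym p.1) (eq_sym p.2) andbC [(_ == _) && (_ == _)]andbC andbC.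
Qed.

Lemma WB3_irr : irreflexive WB3_adj.
Proof. by move=> p; rewrite /WB3_adj eqxx. Qed.

Definition WB3 : bigraph := BiGraph (fun p => p.1 == p.2) WB3_sym WB3_irr.
Definition WC3 : bigraph := BiGraph (fun p => p.1 != p.2) WB3_sym WB3_irr.

End B3.

Section F4.
Local Open Scope ring_scope.

Definition dot (u v : 'rV[rat]_4) : rat := \sum_i u 0 i * v 0 i.

Definition reflection (a v : 'rV[rat]_4) : 'rV[rat]_4 :=
  v - (2 * dot v a / dot a a) *: a.

Definition std (i : 'I_4) : 'rV[rat]_4 := delta_mx 0 i.

(* +-e_i and (+-e_1 +- e_2 +- e_3 +- e_4) / 2 *)
Definition F4_short : seq 'rV[rat]_4 :=
  [seq (-1) ^+ b *: std i | b : bool <- enum {: bool}, i : 'I_4 <- enum 'I_4] ++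
  [seq 2^-1 *: \row_i (-1) ^+ t i | t : {ffun 'I_4 -> bool}].

Definition F4_long : seq 'rV[rat]_4 :=
  [seq (-1) ^+ b.1 *: std p.1 + (-1) ^+ b.2 *: std p.2
  | b : bool * bool <- enum {: bool * bool},
    p : 'I_4 * 'I_4 <- enum [pred p : 'I_4 * 'I_4 | (p.1 < p.2)%N]].

Definition F4_roots : seq 'rV[rat]_4 := F4_short ++ F4_long.

Definition F4_root : Type := seq_sub F4_roots.
HB.instance Definition _ := SubFinite.on F4_root.

Definition i0 : 'I_4 := @Ordinal 4 0 isT.
Definition i1 : 'I_4 := @Ordinal 4 1 isT.
Definition i2 : 'I_4 := @Ordinal 4 2 isT.
Definition i3 : 'I_4 := @Ordinal 4 3 isT.

Lemma I4P (P : 'I_4 -> Prop) : P i0 -> P i1 -> P i2 -> P i3 -> forall i, P i.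
Proof.
by move=> ? ? ? ? [[|[|[|[|//]]]] h]; rewrite (bool_irrelevance h isT).
Qed.

Lemma sum_I4 (F : 'I_4 -> rat) : \sum_i F i = F i0 + F i1 + F i2 + F i3.
Proof.
rewrite !big_ord_recl big_ord0 addr0 !addrA.
by congr (F _ + F _ + F _ + F _); apply: val_inj.
Qed.

(* Roots in doubled integral coordinates, for computation. *)
Definition vec (c : int * int * int * int) : 'rV[rat]_4 :=
  let: (x, y, z, t) := c in
  2^-1 *: \row_i ([:: x; y; z; t]`_i)%:~R.

Lemma vecE x y z t : (vec (x, y, z, t) 0 i0 = x%:~R / 2)
 * (vec (x, y, z, t) 0 i1 = y%:~R / 2)
 * (vec (x, y, z, t) 0 i2 = z%:~R / 2)
 * (vec (x, y, z, t) 0 i3 = t%:~R / 2).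
Proof. by rewrite !mxE /= ![2^-1 * _]mulrC. Qed.

Lemma row4P (u v : 'rV[rat]_4) : u 0 i0 = v 0 i0 -> u 0 i1 = v 0 i1 ->
  u 0 i2 = v 0 i2 -> u 0 i3 = v 0 i3 -> u = v.
Proof.
by move=> ? ? ? ?; apply/matrixP => i; rewrite (ord1 i); apply: I4P.
Qed.

Definition code : Type := (int * int * int * int)%type.
Definition sg (n : int) (b : bool) : int := if b then - n else n.
Definition dlt (i : 'I_4) (b : bool) (k : nat) : int := if k == i then sg 2 b else 0.
Definition tabulate (f : nat -> int) : code := (f 0%N, f 1%N, f 2, f 3).

Lemma vec_tab f : vec (tabulate f) = 2^-1 *: \row_i (f i)%:~R.
Proof. by apply: row4P; rewrite vecE !mxE mulrC. Qed.

Lemma sgE n (b : bool) : (sg n b)%:~R = (-1) ^+ b * n%:~R :> rat.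
Proof. by case: b; rewrite /= ?mul1r // mulN1r rmorphN. Qed.

Lemma stdE (b : bool) i : (-1) ^+ b *: std i = vec (tabulate (dlt i b)).
Proof.
rewrite vec_tab; apply/matrixP => j k; rewrite !mxE /dlt (ord1 j) /=.
case: eqP => [->|ki]; first by rewrite eqxx sgE mulrCA mulVf.
by case: eqP => [kE|_]; [case: ki; apply: val_inj | rewrite !mulr0].
Qed.

Lemma halfE (t : {ffun 'I_4 -> bool}) :
  2^-1 *: \row_i (-1) ^+ t i = vec (sg 1 (t i0), sg 1 (t i1), sg 1 (t i2), sg 1 (t i3)).
Proof. by apply: row4P; rewrite vecE !mxE sgE mulr1 mulrC. Qed.

Lemma longE (b c : bool) i j : (-1) ^+ b *: std i + (-1) ^+ c *: std j =
  vec (tabulate (fun k => dlt i b k + dlt j c k)).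
Proof.
by rewrite !stdE !vec_tab; apply/matrixP => k l; rewrite !mxE rmorphD mulrDr.
Qed.

Definition bb := [:: false; true].
Definition ii := [:: i0; i1; i2; i3].

Definition codes_short : seq code :=
  [seq tabulate (dlt i b) | b <- bb, i <- ii] ++
  flatten [seq flatten [seq flatten [seq [seq (sg 1 x, sg 1 y, sg 1 z, sg 1 t)
    | t <- bb] | z <- bb] | y <- bb] | x <- bb].

Definition codes_long : seq code :=
  flatten [seq [seq tabulate (fun k => dlt p.1 b k + dlt p.2 c k) | b <- bb, c <- bb]
          | p <- [seq p : 'I_4 * 'I_4 <- [seq (i, j) | i <- ii, j <- ii] | (p.1 < p.2)%N]].

Lemma mem_ii i : i \in ii. Proof. by elim/I4P: i. Qed.
Lemma mem_bb b : b \in bb. Proof. by case: b. Qed.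

Lemma F4_shortP v : reflect (exists2 c, c \in codes_short & v = vec c) (v \in F4_short).
Proof.
apply: (iffP idP).
- rewrite mem_cat => /orP[/allpairsP[[b i] /= [_ _ ->]]|/mapP[t _ ->]].
    exists (tabulate (dlt i b)); last exact: stdE.
    by rewrite mem_cat allpairs_f ?mem_ii ?mem_bb.
  exists (sg 1 (t i0), sg 1 (t i1), sg 1 (t i2), sg 1 (t i3)); last exact: halfE.
  by case: (t i0); case: (t i1); case: (t i2); case: (t i3).
- case=> c + ->; rewrite [c \in _]mem_cat [vec c \in _]mem_cat => /orP[/allpairsP[[b i] /= [_ _ ->]]|].
    by rewrite -stdE; apply/orP; left; apply/allpairsP; exists (b, i); rewrite !mem_enum.
  move=> /flatten_mapP[x _ /flatten_mapP[y _ /flatten_mapP[z _ /mapP[t _ ->]]]].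
  apply/orP; right; apply/mapP; exists [ffun i : 'I_4 => nth false [:: x; y; z; t] i].
    by rewrite mem_enum.
  by rewrite halfE !ffunE.
Qed.

Lemma F4_longP v : reflect (exists2 c, c \in codes_long & v = vec c) (v \in F4_long).
Proof.
apply: (iffP idP).
- move=> /allpairsP[[b p] /= [_ pP ->]]; rewrite longE; eexists; last by [].
  apply/flatten_mapP; exists p.
    rewrite mem_filter; move: pP; rewrite mem_enum inE => ->; rewrite andTb.
    by case: p => i j; apply/allpairsP; exists (i, j); rewrite !mem_ii.
  by apply/allpairsP; exists (b.1, b.2); rewrite !mem_bb.
- case=> c /flatten_mapP[p + /allpairsP[[b d] [_ _ ->]]] ->.
  rewrite mem_filter => /andP[pP _]; rewrite -longE.
  by apply/allpairsP; exists ((b, d), p); split; rewrite ?mem_enum.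
Qed.

Definition cdot (a b : code) : int :=
  let: (x, y, z, t) := a in let: (x', y', z', t') := b in
  x * x' + y * y' + z * z' + t * t'.

Definition crefl (a v : code) : code :=
  let: (x, y, z, t) := a in let: (x', y', z', t') := v in
  let k := ((2 * cdot v a)%R %/ cdot a a)%Z in
  (x' - k * x, y' - k * y, z' - k * z, t' - k * t).

Lemma dotE a b : dot (vec a) (vec b) = (cdot a b)%:~R / 4.
Proof.
case: a b => [[[x y] z] t] [[[x' y'] z'] t'].
by rewrite /dot sum_I4 !vecE /cdot !rmorphD !rmorphM /=; field.
Qed.

Lemma creflE a v : cdot a a != 0 -> (cdot a a %| (2 * cdot v a)%R)%Z ->
  reflection (vec a) (vec v) = vec (crefl a v).
Proof.
move=> a0 dv; rewrite /reflection !dotE.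
set k : int := ((2 * cdot v a)%R %/ cdot a a)%Z.
have -> : 2 * ((cdot v a)%:~R / 4) / ((cdot a a)%:~R / 4) = k%:~R :> rat.
  have /(congr1 (fun m : int => m%:~R : rat)) := divzK dv; rewrite -/k !rmorphM /=.
  have {}a0 : (cdot a a)%:~R != 0 :> rat by rewrite intr_eq0.
  by move=> E; field: E.
rewrite /crefl -/k {}/k; case: a v {a0 dv} => [[[x y] z] t] [[[x' y'] z'] t'].
move: (_ %/ _)%Z => k.
have subE (u w : 'rV[rat]_4) i : (u - k%:~R *: w) 0 i = u 0 i - k%:~R * w 0 i.
  by rewrite !mxE.
by apply: row4P; rewrite subE !vecE rmorphD /= rmorphN /= rmorphM /=; field.
Qed.

Lemma F4_rootsP v :
  reflect (exists2 c, c \in codes_short ++ codes_long & v = vec c) (v \in F4_roots).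
Proof.
rewrite mem_cat; apply: (iffP orP).
  by case=> [/F4_shortP|/F4_longP] [c cs ->]; exists c; rewrite // mem_cat cs ?orbT.
by case=> c; rewrite mem_cat => /orP[cs|cs] ->; [left; apply/F4_shortP|right; apply/F4_longP]; exists c.
Qed.

Lemma codes_closed :
  let codes := codes_short ++ codes_long in
  all (fun a => all (fun v => [&& cdot a a != 0, (cdot a a %| (2 * cdot v a)%R)%Z
     & crefl a v \in codes]) codes) codes.
Proof. by vm_compute. Qed.

Lemma reflection_root (a v : F4_root) : reflection (val a) (val v) \in F4_roots.
Proof.
case/F4_rootsP: (valP a) (valP v) => c cC -> /F4_rootsP[d dC ->].
have /allP/(_ c cC)/allP/(_ d dC)/and3P[c0 cd cdC] := codes_closed.
by rewrite creflE //; apply/F4_rootsP; exists (crefl c d).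
Qed.

Lemma dotDl u v w : dot (u + v) w = dot u w + dot v w.
Proof. by rewrite /dot -big_split; apply: eq_bigr => i _; rewrite mxE mulrDl. Qed.

Lemma dotZl k u w : dot (k *: u) w = k * dot u w.
Proof. by rewrite /dot mulr_sumr; apply: eq_bigr => i _; rewrite mxE mulrA. Qed.

Lemma reflectionK a : involutive (reflection a).
Proof.
move=> v; rewrite /reflection -!scaleNr dotDl dotZl -addrA -scalerDl.
have [->|a0] := eqVneq (dot a a) 0; first by rewrite invr0 !mulr0 oppr0 addr0 scale0r addr0.
by rewrite [X in X *: a](_ : _ = 0) ?scale0r ?addr0 //; field.
Qed.

Definition refl_fun (a v : F4_root) : F4_root := SeqSub (reflection_root a v).

Lemma refl_fun_inj a : injective (refl_fun a).
Proof. by apply: (can_inj (g := refl_fun a)) => v; apply: val_inj; apply: reflectionK. Qed.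

Definition refl (a : F4_root) : {perm F4_root} := perm (@refl_fun_inj a).

(* The roots span the ambient space, so that the Weyl group is faithfully
   represented, and represented here, as a group of permutations of the roots. *)
Definition F4_reflections : {set {perm F4_root}} := [set refl a | a : F4_root]%SET.

Definition WeylF4 : {group {perm F4_root}} := <<F4_reflections>>%G.

Definition WF4_vertex : Type := {s : {perm F4_root} | s \in F4_reflections}.
HB.instance Definition _ := SubFinite.on WF4_vertex.

Definition WF4_adj : rel WF4_vertex := fun s t =>
  (s != t) && (val s * val t == val t * val s)%g.

Definition WF4_short : pred WF4_vertex := fun s =>
  [exists a : F4_root, (val a \in F4_short) && (val s == refl a)].

Lemma WF4_sym : symmetric WF4_adj.
Proof. by move=> s t; rewrite /WF4_adj eq_sym [_ == (val t * _)%g]eq_sym. Qed.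

Lemma WF4_irr : irreflexive WF4_adj.
Proof. by move=> s; rewrite /WF4_adj eqxx. Qed.

Definition WF4 : bigraph := BiGraph WF4_short WF4_sym WF4_irr.

Lemma refl_in a : refl a \in F4_reflections.
Proof. exact: imset_f. Qed.

Definition mirror (a : F4_root) : WF4_vertex := exist _ (refl a) (refl_in a).

Lemma root_dot_neq0 (a : F4_root) : dot (val a) (val a) != 0.
Proof.
case/F4_rootsP: (valP a) => c cC ->.
have /allP/(_ c cC)/allP/(_ c cC)/and3P[c0 _ _] := codes_closed.
by rewrite dotE mulf_neq0 // intr_eq0.
Qed.

Lemma dotC u v : dot u v = dot v u.
Proof. by apply: eq_bigr => i _; rewrite mulrC. Qed.

Lemma reflE (a v : F4_root) : val (refl a v) = reflection (val a) (val v).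
Proof. by rewrite permE. Qed.

Lemma reflectionZ k a v : k != 0 -> reflection (k *: a) v = reflection a v.
Proof.
move=> k0; rewrite /reflection scalerA (dotC v) !dotZl (dotC a (k *: a)) dotZl (dotC a v).
have [->|a0] := eqVneq (dot a a) 0; first by rewrite !mulr0 invr0 !mulr0 mul0r.
by congr (_ - _ *: _); field; rewrite a0.
Qed.

Lemma refl_eq k (a b : F4_root) : k != 0 -> val b = k *: val a -> refl b = refl a.
Proof.
by move=> k0 ba; apply/permP => v; apply: val_inj; rewrite !reflE ba reflectionZ.
Qed.

Lemma reflection_self a : dot a a != 0 -> reflection a a = - a.
Proof.
by move=> a0; rewrite /reflection mulfK // scaler_nat mulr2n opprD addrA subrr add0r.
Qed.

Lemma reflection_orth a v : dot v a = 0 -> reflection a v = v.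
Proof. by move=> va; rewrite /reflection va mulr0 mul0r scale0r subr0. Qed.

Lemma mirror_adj (a b : F4_root) :
  WF4_adj (mirror a) (mirror b) = (dot (val a) (val b) == 0).
Proof.
have [a0 b0] := (root_dot_neq0 a, root_dot_neq0 b).
apply/andP/eqP => [[ab /eqP/permP/(_ a)/(congr1 val)]|ab].
- rewrite !permM !reflE reflection_self // => E.
  apply/eqP; apply: contraNT ab => d0; rewrite -val_eqE /=; apply/eqP/esym.
  pose c := 2 * dot (val a) (val b) / dot (val b) (val b).
  have c0 : c != 0 by rewrite !mulf_neq0 ?invr_eq0.
  pose r := reflection (val b) (val a).
  have rN : reflection (val b) (- val a) = - r.
    by rewrite /r /reflection opprB -[in dot (- _) _]scaleN1r dotZl mulN1r mulrN mulNr scaleNr opprK addrC.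
  pose k := 2 * dot r (val a) / dot (val a) (val a).
  have Ek : r *+ 2 = k *: val a.
    have -> : k *: val a = r - (r - k *: val a) by rewrite opprB addrC subrK.
    by move: E; rewrite rN -/r [X in _ = X]/reflection -/k => <-; rewrite opprK mulr2n.
  have Eb : (2 * c) *: val b = (2 - k) *: val a.
    rewrite scalerBl -Ek /r /reflection -/c scaler_nat mulrnBl opprB addrC subrK.
    by rewrite -scalerA scaler_nat.
  have c20 : 2 * c != 0 by rewrite mulf_neq0.
  have bE : val b = ((2 - k) / (2 * c)) *: val a.
    by rewrite mulrC -scalerA -Eb scalerA mulVf ?scale1r.
  apply: (refl_eq _ bE); apply: contraNneq b0 => k0.
  by rewrite bE k0 scale0r -(scale0r 0) dotZl mul0r.
- split.
    apply/negP => /eqP/(congr1 val)/= /permP/(_ a)/(congr1 val); rewrite !reflE.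
    rewrite reflection_self // reflection_orth // => /eqP; rewrite eq_sym -addr_eq0.
    rewrite -mulr2n -scaler_nat scaler_eq0 => /orP[|/eqP a00]; first by []; move: a0.
    by rewrite a00 -(scale0r 0) dotZl mul0r eqxx.
  apply/eqP/permP => v; apply: val_inj; rewrite !permM !reflE /reflection.
  rewrite -!scaleNr !dotDl !dotZl (dotC (val b)) ab !mulr0 !addr0.
  by rewrite -!addrA; congr (_ + _); rewrite addrC.
Qed.

Definition twist_long_vector (i : 'I_4) : 'rV[rat]_4 :=
  [:: std i2 - std i3; std i2 + std i3; std i0 - std i1; std i0 + std i1]`_i.

Definition code_x (i : 'I_4) : code := tabulate (dlt i false).

Definition code_y (i : 'I_4) : code :=
  nth (0, 0, 0, 0)
    [:: (0, 0, 2, -2); (0, 0, 2, 2); (2, -2, 0, 0); (2, 2, 0, 0)] i.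

Definition cneg (c : code) : code :=
  let: (x, y, z, t) := c in (- x, - y, - z, - t).

Lemma vecN c : vec (cneg c) = (-1) *: vec c.
Proof.
case: c => [[[x y] z] t].
by apply: row4P; rewrite [RHS]mxE !vecE mulN1r rmorphN mulNr.
Qed.

Lemma code_xE i : std i = vec (code_x i).
Proof. by rewrite -stdE expr0 scale1r. Qed.

Lemma code_yE i : twist_long_vector i = vec (code_y i).
Proof.
by elim/I4P: i; apply: row4P; rewrite vecE !mxE /= ?mulr1n ?mulr0n.
Qed.

Lemma std_root i : std i \in F4_roots.
Proof.
apply/F4_rootsP; exists (code_x i); last exact: code_xE.
by elim/I4P: i.
Qed.

Lemma twist_long_vector_root i : twist_long_vector i \in F4_roots.
Proof.
apply/F4_rootsP; exists (code_y i); last exact: code_yE.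
by elim/I4P: i.
Qed.

Definition F4_x (i : 'I_4) : WF4_vertex := mirror (SeqSub (std_root i)).
Definition F4_y (i : 'I_4) : WF4_vertex := mirror (SeqSub (twist_long_vector_root i)).

Lemma dot_eq0 c d : (dot (vec c) (vec d) == 0) = (cdot c d == 0).
Proof. by rewrite dotE mulf_eq0 intr_eq0 orbF. Qed.

Definition orth_check (f : 'I_4 -> code) (l : seq code) : bool :=
  all (fun i => all (fun c => (cdot (f i) c == 0) ==>
    has (fun j => (c == f j) || (c == cneg (f j))) ii) l) ii.

Lemma orth_checkP f l i c : orth_check f l -> c \in l -> cdot (f i) c == 0 ->
  exists j k, k != 0 /\ vec c = k *: vec (f j).
Proof.
move=> /allP/(_ i (mem_ii i))/allP/(_ c) H /H/implyP{}H /H/hasP[j _ /orP[]/eqP->].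
  by exists j, 1; rewrite scale1r.
by exists j, (-1); rewrite vecN oppr_eq0.
Qed.

Lemma vec_inj : injective vec.
Proof.
have half_inj (m n : int) : m%:~R / 2 = n%:~R / 2 :> rat -> m = n.
  by move/(mulIf _)=> H; apply: (@intr_inj rat); apply: H.
move=> [[[x y] z] t] [[[x' y'] z'] t'] E.
have H i : vec (x, y, z, t) 0 i = vec (x', y', z', t') 0 i by rewrite E.
move: (H i0) (H i1) (H i2) (H i3); rewrite !vecE.
by do 4! move/half_inj=> ->.
Qed.

Lemma short_long_check :
  all (fun c => all (fun d => crefl d c != cneg c) codes_long) codes_short.
Proof. by vm_compute. Qed.

Lemma short_mirror a : val a \in F4_short -> WF4_short (mirror a).
Proof. by move=> aS; apply/existsP; exists a; rewrite aS eqxx. Qed.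

Lemma long_mirror b : val b \in F4_long -> ~~ WF4_short (mirror b).
Proof.
move=> /F4_longP[d dL bE]; apply/negP => /existsP[a /andP[/F4_shortP[c cS aE]]].
move=> /eqP/esym/permP/(_ a)/(congr1 val); rewrite !reflE.
rewrite reflection_self ?root_dot_neq0 // aE bE.
have /allP/(_ c cS)/allP/(_ d dL)/eqP ncd := short_long_check.
have dR : d \in codes_short ++ codes_long by rewrite mem_cat dL orbT.
have cR : c \in codes_short ++ codes_long by rewrite mem_cat cS.
have /allP/(_ d dR)/allP/(_ c cR)/and3P[d0 dc _] := codes_closed.
by rewrite creflE // -scaleN1r -vecN => /vec_inj/esym.
Qed.

Lemma std_short i : std i \in F4_short.
Proof. by apply/F4_shortP; exists (code_x i); [elim/I4P: i | exact: code_xE]. Qed.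

Lemma twist_vector_long i : twist_long_vector i \in F4_long.
Proof. by apply/F4_longP; exists (code_y i); [elim/I4P: i | exact: code_yE]. Qed.

Lemma mirrorP (s : WF4_vertex) : exists a, s = mirror a.
Proof. by case: s => s sR; have /imsetP[a _ sE] := sR; exists a; apply: val_inj. Qed.

Lemma WF4_twist_data : twist_data (G := WF4) F4_x F4_y.
Proof.
split.
- by move=> i; apply: short_mirror; apply: std_short.
- by move=> i; apply: long_mirror; apply: twist_vector_long.
- move=> i j; rewrite [LHS]mirror_adj /= !code_xE dot_eq0.
  by elim/I4P: i; elim/I4P: j.
- move=> i j; rewrite [LHS]mirror_adj /= !code_yE dot_eq0.
  by elim/I4P: i; elim/I4P: j.
- move=> i z /existsP[a /andP[/F4_shortP[c cS aE] /eqP zE]].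
  have -> : z = mirror a by apply: val_inj.
  rewrite [adj _ _]mirror_adj /= aE code_xE dot_eq0.
  move=> /(orth_checkP (l := codes_short)) [] // j [k [k0 E]]; exists j.
  by apply: val_inj; apply: (refl_eq k0); rewrite /= aE code_xE.
- move=> i z zL; have [a zE] := mirrorP z; move: zL; rewrite zE => aL.
  have /F4_longP[c cS aE] : val a \in F4_long.
    by have := valP a; rewrite mem_cat => /orP[/short_mirror aS|//]; rewrite /long [short _]aS in aL.
  rewrite [adj _ _]mirror_adj /= aE code_yE dot_eq0.
  move=> /(orth_checkP (l := codes_long)) [] // j [k [k0 E]]; exists j.
  by apply: val_inj; apply: (refl_eq k0); rewrite /= aE code_yE.
- move=> i j; rewrite [LHS]mirror_adj /= code_xE code_yE dot_eq0.
  by elim/I4P: i; elim/I4P: j.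
Qed.

(* Any choice of twist_data on WF4 gives an isomorphic graph; the one used here
   consists of the reflections in e_1, e_2, e_3, e_4 and in e_3 - e_4, e_3 + e_4,
   e_1 - e_2, e_1 + e_2. *)
Definition WF4' : bigraph := twisted_copy WF4_twist_data.

End F4.

Definition locally_like_WF4 (G : bigraph) : Prop :=
  (forall x : G, short x -> bigraph_iso (local_graph x) WB3) /\
  (forall x : G, long x -> bigraph_iso (local_graph x) WC3).

(* Main.v *)
Require Import Defs.
From mathcomp Require Import all_boot all_order all_algebra.
From mathcomp Require Import all_fingroup all_solvable.
From mathcomp Require Import boolp classical_sets functions cardinality.
From mathcomp Require Import ring.

(** The six long neighbours of a short vertex form three edges in three different
    long cliques, each edge being shared with one of the other three vertices of
    its short clique, and dually. So a graph locally like W(F_4) amounts to a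
    family of short and of long 4-cliques together with a bijection between the
    edges of the short cliques and those of the long ones: a short and a long
    vertex are adjacent when they lie on corresponding edges. Two edges of one
    clique with a common vertex correspond to edges in different cliques.

    Each of the four hypotheses makes the graph tight: every vertex then has a
    neighbour in every clique of the other colour ([tight_of_card],
    [tight_of_components], [tight_of_diameter], [tight_of_mu]). As a vertex sees
    just three cliques of the other colour, there are three short and three long
    cliques, and the six edges of a clique split into three pairs of opposite
    edges, one pair for each clique of the other colour.

    A vertex is then given by its clique and by three bits of even sum, which tell
    for each clique of the other colour the half to which the vertex belongs. Short
    and long vertices are adjacent according to the sum of one bit of each and of a
    sign which depends on the two cliques only ([label_iso]). Changing reference
    vertices adds to the 3 x 3 matrix of signs a matrix whose rows have even sum
    and one whose columns have even sum; the only invariant is the sum of the nine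
    signs ([model_normal]). Hence there are at most two graphs. W(F_4) is the one
    of sum 1, and since twisting changes exactly one sign, W(F_4)' is the one of
    sum 0 ([Model_WF4], [Model_WF4']).

    The two models with constant signs differ by complementing the adjacency
    between vertices of different colours, so they have the same automorphisms
    ([aut_model]), and it suffices to treat W(F_4). The Weyl group acts on its
    reflections by conjugation, with kernel its centre. Every automorphism arises
    in this way ([aut_induced]): composing with suitable reflections, one makes it
    fix one vertex after another. *)

Local Open Scope classical_set_scope.

Set Implicit Arguments.
Unset Strict Implicit.
Unset Printing Implicit Defensive.

Import GRing.Theory.

(** * Local structure *)

Lemma I3P (P : 'I_3 -> Prop) :
  P (@Ordinal 3 0 isT) -> P (@Ordinal 3 1 isT) -> P (@Ordinal 3 2 isT) -> forall i, P i.
Proof. by move=> ? ? ? [[|[|[|//]]] h]; rewrite (bool_irrelevance h isT). Qed.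

(** Both local graphs, read relative to the colour of x: three vertices n i of the
    colour of x and three edges {e i true, e i false} of the other colour. Since
    the colours of W(B_3) and W(C_3) are exchanged, one description serves short
    and long x, and every lemma on charts holds for both colours at once. *)
Record local_chart (G : bigraph) (x : G) (n : 'I_3 -> G) (e : 'I_3 -> bool -> G) : Prop :=
  LocalChart {
    chart_same : forall z, adj x z -> short z = short x -> exists i, z = n i;
    chart_opp : forall z, adj x z -> short z != short x -> exists i b, z = e i b;
    chart_n : forall i, adj x (n i) /\ short (n i) = short x;
    chart_e : forall i b, adj x (e i b) /\ short (e i b) != short x;
    chart_nn : forall i j, adj (n i) (n j) = (i != j);
    chart_ee : forall i b j c, adj (e i b) (e j c) = (i == j) && (b != c);
    chart_ne : forall i j b, adj (n i) (e j b) = (i == j) }.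

Lemma WB3_adjE p q : WB3_adj p q = (p != q) &&
  ([&& p.1 != q.1, p.1 != q.2, p.2 != q.1 & p.2 != q.2] || ((q.1 == p.2) && (q.2 == p.1))).
Proof.
rewrite /WB3_adj; congr (_ && (_ || _)).
rewrite disjoint_subset; apply/fintype.subsetP/idP => [H|/and4P[h1 h2 h3 h4] z].
  have := H p.1; have := H p.2; rewrite !inE !eqxx orbT !negb_or.
  by move=> /(_ isT)/andP[-> ->] /(_ isT)/andP[-> ->].
by rewrite !inE negb_or => /orP[]/eqP->; rewrite ?h1 ?h2 ?h3 ?h4.
Qed.

(** The edge of long vertices of W(B_3) joined to y_{k,k} has as ends the two
    ordered pairs formed by the other two indices. *)
Definition edge_label (k : 'I_3) (b : bool) : 'I_3 * 'I_3 :=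
  if b then (ordS k, ordS (ordS k)) else (ordS (ordS k), ordS k).

Lemma edge_labelP p : p.1 != p.2 -> exists k b, p = edge_label k b.
Proof.
case: p => i j; elim/I3P: i; elim/I3P: j => //= _.
- by exists (@Ordinal 3 2 isT), true; congr pair; apply: val_inj.
- by exists (@Ordinal 3 1 isT), false; congr pair; apply: val_inj.
- by exists (@Ordinal 3 2 isT), false; congr pair; apply: val_inj.
- by exists (@Ordinal 3 0 isT), true; congr pair; apply: val_inj.
- by exists (@Ordinal 3 1 isT), true; congr pair; apply: val_inj.
- by exists (@Ordinal 3 0 isT), false; congr pair; apply: val_inj.
Qed.

Lemma chart_of_labelling (G : bigraph) (x : G) (f : local_graph x -> 'I_3 * 'I_3) :
  bijective f -> (forall u v, WB3_adj (f u) (f v) = adj u v) ->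
  (forall u : local_graph x, ((f u).1 == (f u).2) = (short (val u) == short x)) ->
  exists n e, local_chart x n e.
Proof.
case=> h fK hK fA fS; pose g p : G := val (h p).
have gA p q : adj (g p) (g q) = WB3_adj p q.
  by rewrite -{2}(hK p) -{2}(hK q) fA.
have gS p : (short (g p) == short x) = (p.1 == p.2) by rewrite -fS hK.
have gx p : adj x (g p).
  by have := valP (h p) => /set_mem; apply.
have gP z : adj x z -> exists p, z = g p.
  move=> xz; have zP : z \in perp [set x] by apply/mem_set => _ ->.
  by exists (f (SigSub zP)); rewrite /g fK.
exists (fun i => g (i, i)), (fun k b => g (edge_label k b)); split.
- by move=> z /gP[[i j] ->] /eqP; rewrite gS => /eqP /= <-; exists i.
- by move=> z /gP[p ->]; rewrite gS => /edge_labelP[k [b ->]]; exists k, b.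
- by move=> i; split=> //; apply/eqP; rewrite gS.
- by move=> k b; split=> //; rewrite gS; elim/I3P: k; case: b.
- by move=> i j; rewrite gA WB3_adjE; elim/I3P: i; elim/I3P: j.
- by move=> i b j c; rewrite gA WB3_adjE; elim/I3P: i; elim/I3P: j; case: b; case: c.
- by move=> i j b; rewrite gA WB3_adjE; elim/I3P: i; elim/I3P: j; case: b.
Qed.

Lemma local_chart_exists (G : bigraph) : locally_like_WF4 G ->
  forall x : G, exists n e, local_chart x n e.
Proof.
move=> [GS GL] x; have [xS|xL] := boolP (short x).
  have [f [fb fA fS]] := GS x xS.
  by apply: (chart_of_labelling (f := f)) => // u; rewrite xS eqb_id; exact: fS.
have [f [fb fA fS]] := GL x xL.
apply: (chart_of_labelling (f := f)) => // u.
by rewrite (negbTE xL) eqbF_neg -[LHS]negbK; congr negb; exact: fS.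
Qed.

(** The 4-cliques are the components of the graphs of one colour; adjacency of
    equally coloured vertices is transitive, so x and y need at most one step. *)
Definition clq (G : bigraph) (x y : G) : Prop := short x = short y /\ (x = y \/ adj x y).

Definition reach (G : bigraph) (x y : G) : Prop := exists2 z, clq y z & adj x z.

Definition tight (G : bigraph) : Prop :=
  forall x y : G, short x != short y -> reach x y.

Section LocalStructure.
Variable G : bigraph.
Hypothesis Gchart : forall x : G, exists n e, local_chart x n e.
Implicit Types x y z : G.

Lemma clq_refl x : clq x x. Proof. by split=> //; left. Qed.

Lemma clq_sym x y : clq x y -> clq y x.
Proof. by case=> s [->|a]; split=> //; [left|right; rewrite adj_sym]. Qed.

Lemma clq_trans x y z : clq x y -> clq y z -> clq x z.
Proof.
case=> sxy [->//|axy] [syz [<-|ayz]]; first by split=> //; right.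
split; first by rewrite sxy.
have [n [e C]] := Gchart y.
rewrite adj_sym in axy.
have [i ->] := chart_same C axy sxy; have [j ->] := chart_same C ayz (esym syz).
by rewrite (chart_nn C); case: eqVneq => [->|_]; [left|right].
Qed.

Lemma clq_short x y : clq x y -> short y = short x. Proof. by case. Qed.

Lemma clq_adj x y : clq x y -> x <> y -> adj x y. Proof. by case=> _ []. Qed.

Lemma adj_clq x y : adj x y -> short x = short y -> clq x y.
Proof. by split=> //; right. Qed.

Lemma adj_neq x y : adj x y -> x <> y.
Proof. by move=> a E; rewrite E adj_irr in a. Qed.

Section Chart.
Variables (x : G) (n : 'I_3 -> G) (e : 'I_3 -> bool -> G).
Hypothesis C : local_chart x n e.

Lemma chart_n_inj : injective n.
Proof. by move=> i j E; apply/eqP; rewrite -[_ == _]negbK -(chart_nn C) E adj_irr. Qed.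

Lemma chart_clq z : clq x z -> z = x \/ exists i, z = n i.
Proof.
by case=> s [->|a]; [left|right; apply: (chart_same C a (esym s))].
Qed.

Lemma chart_clq_n i : clq x (n i).
Proof. by have [a s] := chart_n C i; split=> //; right. Qed.

Lemma chart_e_short i b j c : short (e i b) = short (e j c).
Proof.
have [_] := chart_e C i b; have [_] := chart_e C j c.
by case: (short x); case: (short _); case: (short _).
Qed.

Lemma chart_clq_e i b j c : clq (e i b) (e j c) <-> i = j.
Proof.
split=> [[_ [E|]]|->].
- by have := chart_ee C i b j (~~ c); rewrite E (chart_ee C) eqxx; case: c {E};
    case: (i =P j).
- by rewrite (chart_ee C) => /andP[/eqP].
- split; first exact: chart_e_short.
  by rewrite (chart_ee C) eqxx; case: b; case: c; [left|right|right|left].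
Qed.

End Chart.

Lemma opp_clq x y z : short x != short y -> clq y z -> short x != short z.
Proof. by move=> h [<-]. Qed.

Lemma edge_common x x' : clq x x' -> x <> x' ->
  exists y, [/\ short x != short y, adj x y & adj x' y].
Proof.
move=> c ne; have [n [e C]] := Gchart x.
have [E|[i E]] := chart_clq C c; first by case: ne.
exists (e i true); have [a s] := chart_e C i true; split=> //.
  by rewrite eq_sym.
by rewrite E (chart_ne C).
Qed.

Lemma edge_common_clq x x' y z : clq x x' -> x <> x' ->
  short x != short y -> short x != short z ->
  adj x y -> adj x' y -> adj x z -> adj x' z -> clq y z.
Proof.
move=> c ne sy sz ay ay' az az'; have [n [e C]] := Gchart x.
have [E|[i E]] := chart_clq C c; first by case: ne.
rewrite eq_sym in sy; rewrite eq_sym in sz.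
have [j [b Ey]] := chart_opp C ay sy; have [k [d Ez]] := chart_opp C az sz.
move: ay' az'; rewrite Ey Ez E !(chart_ne C) => /eqP ij /eqP ik.
by apply/(chart_clq_e C); rewrite -ij.
Qed.

(** The edge of the clique of x that corresponds to the edge of y seen by x: within
    the clique of x, the vertex y sees exactly the two ends of that edge. *)
Lemma partner x y : short x != short y -> adj x y ->
  exists x', [/\ clq x x', x <> x', adj x' y &
     forall z, clq x z -> adj z y -> z = x \/ z = x'].
Proof.
move=> s a; have [n [e C]] := Gchart x; rewrite eq_sym in s.
have [i [b Ey]] := chart_opp C a s.
exists (n i); rewrite Ey (chart_ne C) eqxx; split=> //.
- exact: chart_clq_n C i.
- by move/esym=> E; have [] := chart_n C i; rewrite E adj_irr.
move=> z /(chart_clq C)[->|[j ->]]; first by left.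
by rewrite (chart_ne C) => /eqP ->; right.
Qed.

(** The common neighbours of x and x' are the two ends of a single edge, and each of
    x and x' sees no other vertex of the clique containing that edge. *)
Lemma twin x x' y y' : short x != short y -> clq x x' -> clq y y' ->
  adj x y -> adj x' y -> adj x y' -> adj x' y'.
Proof.
move=> s cx cy a a' a''; have [n [e C]] := Gchart x.
have [->//|[i E]] := chart_clq C cx; move: a'; rewrite E {x' cx E}.
have s' : short x != short y' by case: cy => <-.
rewrite eq_sym in s; rewrite eq_sym in s'.
have [j [b Ey]] := chart_opp C a s; have [k [d Ez]] := chart_opp C a'' s'.
move: cy; rewrite Ey Ez !(chart_ne C) => /(chart_clq_e C)<- //.
Qed.

Lemma missed x y : short x != short y -> adj x y ->
  exists2 y', clq y y' & ~~ adj x y'.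
Proof.
move=> s a; have [n [e C]] := Gchart y; rewrite adj_sym in a.
have [i [b ->]] := chart_opp C a s.
exists (n (ordS i)); first exact: chart_clq_n C _.
by rewrite adj_sym (chart_ne C); elim/I3P: i.
Qed.

(** When x misses y' but sees y, the two pairs seen by y and y' fill up the
    4-clique of x. *)
Lemma complementary_pairs m m' y y' : short m != short y -> clq m m' -> clq y y' ->
  adj m y -> ~~ adj m y' -> adj m' y' -> forall x, clq m x -> adj x y' = ~~ adj x y.
Proof.
move=> s cm cy a na a' x cx.
have s' : short m != short y' := opp_clq s cy.
have sw z : clq m z -> adj z y -> ~~ adj z y'.
  move=> cz az; apply: contra na => az'; rewrite adj_sym.
  apply: (@twin y y' z m); rewrite 1?(adj_sym y) 1?(adj_sym y') //.
  - by case: cz => <- _; rewrite eq_sym.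
  - exact: clq_sym.
(* By sw, being seen by y or by y' already excludes the other. *)
suff : adj x y \/ adj x y'.
  by case=> [h|h]; [rewrite h (negbTE (sw _ cx h))|case: (boolP (adj x y)) (sw _ cx) => // _ /(_ isT); rewrite h].
have [n [e C]] := Gchart m.
rewrite eq_sym in s; have [i [b Ey]] := chart_opp C a s.
have [E|[j Ej]] := chart_clq C cm; first by rewrite -E a' in na.
have sm'y : short m' != short y' by case: cm => <-.
have [m'' [cm'' ne'' a'' _]] := partner sm'y a'.
have [E|[k Ek]] := chart_clq C (clq_trans cm cm''); first by rewrite -E a'' in na.
(* The clique of m is made of m, n i (seen with m by y) and of m', m'' (seen by y'). *)
have ij : i != j.
  apply/eqP => ij; have a1 : adj m' y by rewrite Ey Ej (chart_ne C) ij.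
  by have := sw _ cm a1; rewrite a'.
have ik : i != k.
  apply/eqP => ik; have a1 : adj m'' y by rewrite Ey Ek (chart_ne C) ik.
  by have := sw _ (clq_trans cm cm'') a1; rewrite a''.
have jk : j != k by apply/eqP => jk; apply: ne''; rewrite Ej Ek jk.
have [->|[l El]] := chart_clq C cx; first by left.
have [il|il] := eqVneq l i; first by left; rewrite El il Ey (chart_ne C).
right; have [El'|El'] : x = m' \/ x = m'' by
  rewrite El Ej Ek; move: ij ik jk il; elim/I3P: (i); elim/I3P: (j); elim/I3P: (k);
    elim/I3P: (l) => //= *; first [by left|by right].
  by rewrite El'.
by rewrite El'.
Qed.

(** Two cliques of different colours split into halves so that adjacency is
    membership in corresponding halves: any two vertices y, y' of one of them are
    either seen by the same vertices of the other, or by complementary pairs. *)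
Lemma exchange x x' y y' : tight G -> short x != short y -> clq x x' -> clq y y' ->
  adj x' y' = adj x y (+) adj x y' (+) adj x' y.
Proof.
move=> T s cx cy.
suff H : exists b, forall z, clq x z -> adj z y' = adj z y (+) b.
  have [b bP] := H; rewrite (bP _ cx) (bP _ (clq_refl x)).
  by case: b {bP}; case: (adj x y); case: (adj x' y).
have [m cm am] : reach y x by apply: T; rewrite eq_sym.
rewrite adj_sym in am.
have smy : short m != short y by case: cm => <-.
have [a|na] := boolP (adj m y').
  exists false => z cz; rewrite addbF.
  have cmz : clq m z := clq_trans (clq_sym cm) cz.
  have syy : short m != short y' := opp_clq smy cy.
  by apply/idP/idP => az; [apply: (@twin m z y' y)|apply: (@twin m z y y')] => //; exact: clq_sym.
have [m' cm' am'] : reach y' x by apply: T; case: cy => <-; rewrite eq_sym.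
exists true => z cz; rewrite addbT.
apply: (complementary_pairs (m := m) (m' := m')) => //; rewrite 1?adj_sym //.
  exact: clq_trans (clq_sym cm) cm'.
exact: clq_trans (clq_sym cm) cz.
Qed.

End LocalStructure.

(** * The four hypotheses imply tightness *)

Section Tightness.
Variable G : bigraph.
Hypothesis Gchart : forall x : G, exists n e, local_chart x n e.
Implicit Types x y z : G.

Lemma nbr_cliques x : exists e : 'I_3 -> G,
  [/\ forall i, adj x (e i) /\ short x != short (e i),
      forall i j, clq (e i) (e j) -> i = j &
      forall z, short x != short z -> adj x z -> exists i, clq (e i) z].
Proof.
have [n [e C]] := Gchart x; exists (fun i => e i true); split.
- by move=> i; rewrite eq_sym; apply: (chart_e C).
- by move=> i j /(chart_clq_e C).
- move=> z; rewrite eq_sym => s a; have [i [b ->]] := chart_opp C a s; exists i.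
  exact/(chart_clq_e C).
Qed.

Lemma reach_clq x y y' : clq y y' -> reach x y -> reach x y'.
Proof. by move=> c [z cz a]; exists z => //; apply: clq_trans cz => //; apply: clq_sym. Qed.

Lemma linked_induced_clq (X : set G) (u v : induced X) :
  (forall a b : G, X a -> X b -> short a = short b) -> linked u v ->
  clq (val u) (val v).
Proof.
move=> mono [k [p [pth <- _]]]; elim: p u pth => [|w p IH] u /=.
  by move=> _; apply: clq_refl.
move=> /andP[a /IH]; apply: clq_trans => //; apply: adj_clq => //.
by apply: mono; apply: set_valP.
Qed.

(** Linked vertices of one colour lie in one clique, so a neighbour in the component
    of y is a neighbour in its clique. *)
Lemma tight_of_components : tightly_connected G -> tight G.
Proof.
case=> TL TS x y sxy; have [yS|yL] := boolP (short y).
  have xL : long x by rewrite /long; move: sxy; rewrite yS; case: (short x).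
  have yX : y \in [set x : G | short x] by exact/mem_set.
  pose u : short_graph G := SigSub yX.
  have [v uv a] := TL x xL [set v | linked u v] (ex_intro _ u erefl).
  exists (val v) => //.
  by apply: (@linked_induced_clq _ u v _ uv) => a' b' /= -> ->.
have xS : short x by move: sxy; rewrite (negbTE yL); case: (short x).
have yX : y \in [set x : G | long x] by exact/mem_set.
pose u : long_graph G := SigSub yX.
have [v uv a] := TS x xS [set v | linked u v] (ex_intro _ u erefl).
exists (val v) => //.
by apply: (@linked_induced_clq _ u v _ uv) => a' b' /= /negbTE-> /negbTE->.
Qed.

(** If x missed the clique of y, then each vertex of that clique, being at
    distance 2 from x, would see a vertex of the clique of x; by covering, x
    itself would be seen from the clique of y. *)
Lemma tight_of_diameter : has_diameter G 2 -> tight G.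
Proof.
case=> D _ x y s; apply: contrapT => nr.
have H y' : clq y y' -> exists2 m, clq x m & adj m y'.
  move=> c; have s' : short x != short y' := opp_clq s c.
  have nxy' : ~ adj x y' by move=> a; apply: nr; exists y'.
  have [k k2 [[p [pth lst sz]] _]] := D x y'.
  move: pth lst sz; case: p => [|m [|m' [|m3 p]]] /=.
  - by move=> _ E; rewrite E eqxx in s'.
  - by rewrite andbT => a E; rewrite E in a.
  - rewrite andbT => /andP[a a'] E _; rewrite E in a'.
    have [sm|sm] := eqVneq (short m) (short x); first by exists m => //; apply: adj_clq.
    case: nr; exists m => //; apply: clq_trans c _ => //; apply: clq_sym.
    by apply: adj_clq => //; move: s' sm; case: (short x); case: (short m); case: (short y').
  - by move=> _ _ sz; move: k2; rewrite -sz.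
have [m cm am] := H y (clq_refl y).
have sm : short m != short y by case: cm => <-.
have [y' cy nam] := missed Gchart sm am.
have [m' cm' am'] := H y' cy.
have cmm : clq m m' := clq_trans Gchart (clq_sym cm) cm'.
have := complementary_pairs Gchart sm cmm cy am nam am' (clq_sym cm).
have [a|na] := boolP (adj x y) => /= a'; first by apply: nr; exists y => //; apply: clq_refl.
by apply: nr; exists y'.
Qed.

Lemma clq_enum x : exists f : option 'I_3 -> G, injective f /\ forall k, clq x (f k).
Proof.
have [n [e C]] := Gchart x; exists (fun k => if k is Some i then n i else x).
have nx i : n i <> x by move=> E; have [] := chart_n C i; rewrite E adj_irr.
split=> [[i|] [j|] // /esym E|[i|]]; first by rewrite (chart_n_inj C E).
- by case: (nx i).
- by case: (nx j).
- exact: chart_clq_n C i.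
- exact: clq_refl.
Qed.

(** Inequivalent vertices span disjoint cliques of 4 vertices each. *)
Lemma card_of_cliques (I : finType) (r : I -> G) k :
  (forall i j, clq (r i) (r j) -> i = j) -> ([set: G] #= `I_k)%card -> #|I| * 4 <= k.
Proof.
move=> rinj /card_set_bijP[f [fI finj _]].
have [g gP] := choice (fun i => clq_enum (r i)).
have fk x : f x < k by apply: (fI x).
pose h (p : I * option 'I_3) : 'I_k := Ordinal (fk (g p.1 p.2)).
have hinj : injective h.
  move=> [i a] [j b] /(congr1 val) /= fE.
  have E : g i a = g j b by apply: finj fE; rewrite inE.
  have [[ga gc] [gb gd]] := (gP i, gP j).
  have ij : i = j.
    by apply: rinj; apply: clq_trans (gc a) _ => //; rewrite E; apply: clq_sym.
  by move: E; rewrite -ij => /ga ->.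
by have := leq_card h hinj; rewrite card_prod card_option !card_ord.
Qed.

(** A clique missed by x, the three cliques seen by x, and the three cliques
    seen by a vertex of the missed clique already hold 28 vertices. *)
Lemma tight_of_card : ([set: G] #= `I_24)%card -> tight G.
Proof.
move=> card x y s; apply: contrapT => nr.
have [e [eP einj _]] := nbr_cliques x; have [d [dP dinj _]] := nbr_cliques y.
pose r (i : option 'I_3 + 'I_3) : G :=
  match i with inl None => y | inl (Some i) => e i | inr j => d j end.
have ne i : ~ clq y (e i) by move=> c; apply: nr; exists (e i) => //; case: (eP i).
have sde i j : ~ clq (e i) (d j).
  case=> E; have [_] := eP i; have [_] := dP j; rewrite -E.
  by move: s; case: (short x); case: (short y); case: (short _).
have syd j : ~ clq y (d j) by case=> E; have [_] := dP j; rewrite E eqxx.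
have rinj i j : clq (r i) (r j) -> i = j.
  case: i j => [[i|]|i] [[j|]|j] //= c.
  - by rewrite (einj _ _ c).
  - by case: (ne i); apply: clq_sym.
  - by case: (sde i j).
  - by case: (ne j).
  - by case: (syd j).
  - by case: (sde j i); apply: clq_sym.
  - by case: (syd i); apply: clq_sym.
  - by rewrite (dinj _ _ c).
by have := card_of_cliques rinj card; rewrite card_sum card_option !card_ord.
Qed.

Lemma at_distance2 x y z : adj x z -> adj z y -> x <> y -> ~~ adj x y -> at_distance 2 x y.
Proof.
move=> xz zy nxy na; split; first by exists [:: z; y]; rewrite /= xz zy.
move=> [|[|//]] _ [[|w [|w' p]] //= []] //.
by rewrite andbT => + E _; rewrite E (negbTE na).
Qed.

Section MuThree.
Hypothesis mu3 : forall x y : G, short x = short y -> at_distance 2 x y -> mu_is x y 3.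

(** Three pairwise non-adjacent common neighbours exhaust the three cliques seen
    by either vertex. *)
Lemma reach_dist2 x x' y : short x = short x' -> at_distance 2 x x' ->
  short x != short y -> reach x y -> reach x' y.
Proof.
move=> ss D s [z cz az].
have [nxx' naxx'] : x <> x' /\ ~ adj x x'.
  case: D => _ D; split=> [E|a]; first by apply: (D 0) => //; exists [::].
  by apply: (D 1) => //; exists [:: x']; rewrite /= a.
have /card_set_bijP[f [_ _ fsurj]] := mu3 ss D.
have /choice[g gP] (i : 'I_3) : exists v, perp [set x; x'] v /\ f v = i.
  by have [v vP fv] := fsurj i (ltn_ord i); exists v.
have fP i : [/\ adj x (g i), adj x' (g i) & short x != short (g i)].
  have [fi _] := gP i; have [a a'] : adj x (g i) /\ adj x' (g i).
    by split; apply: fi; [left|right].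
  split=> //; apply/eqP => E; apply: naxx'; apply: clq_adj => //.
  apply: clq_trans (adj_clq a E) _ => //; apply: clq_sym; apply: adj_clq => //.
  by rewrite -ss.
have fclq i j : clq (g i) (g j) -> i = j.
  move=> c; apply: contrapT => ij; apply: naxx'; apply: clq_adj => //.
  have [a1 a1' s1] := fP i; have [a2 a2' s2] := fP j.
  apply: (edge_common_clq Gchart c); rewrite 1?adj_sym //.
  - by move=> E; apply: ij; apply: val_inj; rewrite /= -(gP i).2 -(gP j).2 E.
  - by rewrite eq_sym.
  - by rewrite -ss eq_sym.
have [e [eP einj eall]] := nbr_cliques x.
have sz : short x != short z := opp_clq s cz.
have /choice[k kP] i : exists j, clq (e j) (g i).
  by have [a _ s'] := fP i; apply: eall.
have kinj : injective k.
  move=> i j E; apply: fclq; apply: clq_trans (kP j) => //.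
  by rewrite -E; apply: clq_sym.
have [k' _ kK] := injF_bij kinj.
have [i iP] := eall z sz az; have [_ a' _] := fP (k' i).
exists (g (k' i)) => //; apply: clq_trans cz _ => //.
by apply: clq_trans (clq_sym iP) _ => //; rewrite -{1}(kK i).
Qed.

(** The vertices x and x' see a common w, and w has a clique mate w' that neither of
    them sees. The vertices seen by both w and w' lie outside the clique of x, at
    distance 2 from x and from x', so they see the same cliques as both. *)
Lemma reach_adj x x' y : short x = short x' -> adj x x' ->
  short x != short y -> reach x y -> reach x' y.
Proof.
move=> ss a s r; have c : clq x x' := adj_clq a ss.
have [w [sw aw aw']] := edge_common Gchart c (adj_neq a).
have [w' cw naw] := missed Gchart sw aw.
have naw' : ~~ adj x' w'.
  apply: contra naw => aw''; apply: (twin Gchart _ (clq_sym c) cw aw' aw) => //.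
  by rewrite -ss.
have ww' : w <> w' by move=> E; rewrite -E aw in naw.
have [u [su au au']] := edge_common Gchart cw ww'.
have sxu : short x = short u by move: sw su; case: (short x); case: (short u); case: (short w).
have far v : clq x v -> adj v w -> ~~ adj v w' -> at_distance 2 v u.
  move=> cv av nav; have vu : v <> u by move=> E; rewrite E adj_sym au' in nav.
  apply: (at_distance2 av au vu); apply/negP => avu.
  have cvu : clq v u by apply: adj_clq => //; case: cv => <-.
  move/negP: nav; apply; apply: (twin Gchart _ (clq_sym cvu) cw _ av).
  - by rewrite eq_sym.
  - by rewrite adj_sym.
  - by rewrite adj_sym.
have r' : reach u y.
  by apply: (reach_dist2 _ _ _ r) => //; apply: far => //; apply: clq_refl.
apply: (reach_dist2 _ _ _ r') => //; rewrite -?sxu //.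
have [[p [pth lst sz]] D] := far x' c aw' naw'.
apply: (at_distance2 (z := w)); rewrite 1?adj_sym //.
  by move=> E; apply: (D 0) => //; exists [::]; rewrite /= E.
by apply/negP => aux; apply: (D 1) => //; exists [:: u]; rewrite /= aux.
Qed.

Lemma reach_common x x' y z : short x = short x' -> adj x z -> adj x' z ->
  short x != short y -> reach x y -> reach x' y.
Proof.
move=> ss a a' s r; have [<-//|ne] := pselect (x = x').
have [axx|nxx] := boolP (adj x x'); first exact: reach_adj r.
by apply: reach_dist2 r => //; apply: (at_distance2 (z := z)) => //; rewrite adj_sym.
Qed.

(** Walk from x to y: every vertex of the colour of x on the way sees only cliques
    that x sees, and every vertex of the other colour lies in a clique seen by x. *)
Lemma tight_of_mu : connected G -> tight G.
Proof.
case=> _ conn x y s; have [k [p [pth lst _]]] := conn x y.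
suff H v : path adj v p -> (short v = short x -> forall w, short x != short w ->
     reach v w -> reach x w) -> (short v != short x -> reach x v) ->
   short (last v p) != short x -> reach x (last v p).
  by rewrite -lst; apply: H; rewrite ?lst 1?eq_sym // eqxx.
elim: p v {pth lst} => [|v' p IH] v /=; first by move=> _ _.
move=> /andP[a pth] same opp; apply: IH => // s'.
  move=> w sw r; have [sv|sv] := eqVneq (short v) (short x).
    by apply: same => //; apply: (reach_adj _ _ _ r); rewrite ?s' 1?adj_sym.
  have [z cz az] := opp sv.
  have [E|nvz] := pselect (v = z).
    by apply: (reach_common (z := z) _ _ _ _ r); rewrite ?s' // adj_sym -E.
  have [u [su au au']] := edge_common Gchart cz nvz.
  have sxu : short u = short x.
    by move: sv su; case: (short u); case: (short v); case: (short x).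
  have r' : reach u w by apply: (reach_common (z := v) _ _ _ _ r); rewrite ?s' // adj_sym.
  by apply: (reach_common (z := z) _ _ _ _ r'); rewrite ?sxu // adj_sym.
have [sv|sv] := eqVneq (short v) (short x).
  by apply: same => //; [rewrite eq_sym|exists v' => //; apply: clq_refl].
apply: reach_clq (opp sv); apply: adj_clq => //.
by move: sv s'; case: (short v); case: (short x); case: (short v').
Qed.

End MuThree.
End Tightness.

(** * Coordinates on a tight graph *)

Definition o0 : 'I_3 := @Ordinal 3 0 isT.
Definition o1 : 'I_3 := @Ordinal 3 1 isT.
Definition o2 : 'I_3 := @Ordinal 3 2 isT.

(** Colour, index of the clique, and the first two of the three bits; the third one
    is their sum. *)
Definition label : finType := (bool * 'I_3 * (bool * bool))%type.

Definition bit (p : label) (j : 'I_3) : bool :=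
  nth false [:: p.2.1; p.2.2; p.2.1 (+) p.2.2] j.

(** S is indexed by a short clique first and a long clique second, so the indices
    are exchanged when the first vertex is long. *)
Definition sign_of (S : 'I_3 -> 'I_3 -> bool) (c : bool) (i j : 'I_3) : bool :=
  if c then S i j else S j i.

Definition model_adj (S : 'I_3 -> 'I_3 -> bool) : rel label := fun p q =>
  if p.1.1 == q.1.1 then (p.1.2 == q.1.2) && (p != q)
  else bit p q.1.2 (+) bit q p.1.2 (+) sign_of S p.1.1 p.1.2 q.1.2.

Lemma model_sym S : symmetric (model_adj S).
Proof.
move=> p q; rewrite /model_adj /sign_of eq_sym.
case: (boolP (_ == _)) => [_|]; first by rewrite eq_sym (eq_sym p).
by case: p.1.1; case: q.1.1 => // _; rewrite [bit p _ (+) _]addbC.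
Qed.

Lemma model_irr S : irreflexive (model_adj S).
Proof. by move=> p; rewrite /model_adj !eqxx. Qed.

Definition Model S : bigraph :=
  BiGraph (fun p : label => p.1.1) (@model_sym S) (@model_irr S).

Lemma iso_trans (G H K : bigraph) : bigraph_iso G H -> bigraph_iso H K -> bigraph_iso G K.
Proof.
move=> [f [fb fa fs]] [g [gb ga gs]]; exists (g \o f); split.
- exact: bij_comp.
- by move=> x y; rewrite /= ga fa.
- by move=> x; rewrite /= gs fs.
Qed.

Lemma iso_sym (G H : bigraph) : bigraph_iso G H -> bigraph_iso H G.
Proof.
move=> [f [[g fK gK] fa fs]]; exists g; split.
- by exists f.
- by move=> x y; rewrite -fa !gK.
- by move=> x; rewrite -fs gK.
Qed.

Section Coordinates.
Variable G : bigraph.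
Hypothesis Gchart : forall x : G, exists n e, local_chart x n e.
Hypothesis T : tight G.
Implicit Types x y z : G.

(** The three cliques seen by a vertex y are all the cliques of the other colour. *)
Lemma clique_reps y : exists r : 'I_3 -> G,
  [/\ forall i, short (r i) = ~~ short y, forall i j, clq (r i) (r j) -> i = j &
      forall z, short z = ~~ short y -> exists i, clq (r i) z].
Proof.
have [e [eP einj eall]] := nbr_cliques Gchart y; exists e; split=> //.
  by move=> i; have [_] := eP i; case: (short y); case: (short _).
move=> z sz; have syz : short y != short z by rewrite sz; case: (short y).
have [w cw a] := T syz; have [i iP] := eall w (opp_clq syz cw) a; exists i.
exact: clq_trans (clq_sym cw).
Qed.

Variable r : bool -> 'I_3 -> G.
Hypothesis r_short : forall c i, short (r c i) = c.
Hypothesis r_inj : forall c i j, clq (r c i) (r c j) -> i = j.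
Hypothesis r_all : forall z, exists i, clq (r (short z) i) z.

Definition clique_index z : 'I_3 := projT1 (cid (r_all z)).

Lemma clique_indexP z : clq (r (short z) (clique_index z)) z.
Proof. exact: projT2 (cid (r_all z)). Qed.

Lemma clique_index_eq x y : short x = short y ->
  clq x y <-> clique_index x = clique_index y.
Proof.
move=> s; have := clique_indexP y; have := clique_indexP x; rewrite -s => cx cy.
split=> [c|E]; last by rewrite E in cx; apply: clq_trans cy => //; apply: clq_sym.
apply: (r_inj (c := short x)); apply: clq_trans cx _ => //.
by apply: clq_trans c _ => //; apply: clq_sym.
Qed.

(** The bit at j compares z with the reference vertex of its own clique, from the
    point of view of the reference vertex of the j-th clique of the other colour.
    This makes all bits of a reference vertex vanish. *)
Definition vbit z (j : 'I_3) : bool :=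
  adj z (r (~~ short z) j) (+) adj (r (short z) (clique_index z)) (r (~~ short z) j).

Lemma adj_vbit x y : short x != short y ->
  adj x y = vbit x (clique_index y) (+) vbit y (clique_index x)
            (+) adj (r (short x) (clique_index x)) (r (short y) (clique_index y)).
Proof.
move=> s; have sE : short y = ~~ short x by move: s; case: (short x); case: (short y).
have cx := clique_indexP x; have cy := clique_indexP y.
rewrite (exchange Gchart T _ cx cy); last by rewrite !r_short.
rewrite /vbit sE negbK in cy *; rewrite [adj y _]adj_sym.
rewrite [adj (r (~~ _) _) (r (short x) _)]adj_sym.
by case: (adj x _); case: (adj _ y); case: (adj _ _).
Qed.

(** Two vertices of a clique have common neighbours in exactly one clique of the
    other colour, and complementary neighbourhoods in the other two. *)
Lemma clique_edge x x' : clq x x' -> x <> x' ->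
  exists k, forall j, vbit x j (+) vbit x' j = (j != k).
Proof.
move=> c ne; have [y [s a a']] := edge_common Gchart c ne.
have ss : short x' = short x := clq_short c.
have sy : short y = ~~ short x by move: s; case: (short x); case: (short y).
have [k] := r_all y; rewrite sy => ck; exists k => j.
have iE : clique_index x' = clique_index x by apply/esym/clique_index_eq.
rewrite /vbit ss iE addbACA addbb addbF.
set w := r _ j; have sw : short x != short w by rewrite r_short; case: (short x).
case: eqVneq => [jk|jk].
  have cyw : clq y w by rewrite /w jk; apply: clq_sym.
  suff -> : adj x w = adj x' w by rewrite addbb.
  apply/idP/idP => aw; first exact: (twin Gchart s c cyw a a' aw).
  by apply: (twin Gchart _ (clq_sym c) cyw a' a aw); rewrite ss.
have [v cv av] := T sw; have svx : short x != short v := opp_clq sw cv.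
have := exchange Gchart T svx c (clq_sym cv); rewrite av.
have -> : adj x' v = false.
  apply/negP => av'; move/eqP: jk; apply; apply: (r_inj (c := ~~ short x)).
  apply: clq_trans cv _ => //; apply: clq_trans (clq_sym ck) => //.
  exact: (edge_common_clq Gchart c).
by move=> ->; case: (adj x w).
Qed.

Definition label_of z : label := (short z, clique_index z, (vbit z o0, vbit z o1)).

Lemma vbit_rep c i j : vbit (r c i) j = false.
Proof.
rewrite /vbit r_short; have -> : clique_index (r c i) = i; last exact: addbb.
by have := clique_indexP (r c i); rewrite r_short => /r_inj.
Qed.

(** The three bits have even sum: they vanish at the reference vertex, and by
    [clique_edge] any other vertex of its clique differs from it in two bits. *)
Lemma bit_label z j : bit (label_of z) j = vbit z j.
Proof.
rewrite /bit /=; have c := clique_indexP z.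
have [E|ne] := pselect (r (short z) (clique_index z) = z).
  by rewrite -E !vbit_rep; elim/I3P: j.
have [k kP] := clique_edge c ne.
have V i : vbit z i = (i != k) by rewrite -kP vbit_rep addFb.
by rewrite !V; elim/I3P: j; elim/I3P: k {kP V}.
Qed.

Lemma label_of_inj : injective label_of.
Proof.
move=> x y E; have Eb j : vbit x j = vbit y j by rewrite -!bit_label E.
case: E => s iE _ _; apply: contrapT => ne.
have [k kP] := clique_edge ((clique_index_eq s).2 iE) ne.
by have := (kP o0, kP o1); rewrite !Eb !addbb; elim/I3P: k {kP} => -[].
Qed.

Lemma label_of_surj p : exists z, label_of z = p.
Proof.
case: p => [[c i] b]; pose x := r c i.
have sx : short x = c := r_short c i.
have ix : clique_index x = i by have := clique_indexP x; rewrite sx => /r_inj.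
suff [z [cz z0 z1]] : exists z, [/\ clq x z, vbit z o0 = b.1 & vbit z o1 = b.2].
  exists z; rewrite /label_of z0 z1 (clq_short cz) sx.
  by rewrite -((clique_index_eq (esym (clq_short cz))).1 cz) ix -surjective_pairing.
(* Besides the zero vector, the even ones have a single zero, at k say: they are
   realised by following the edge at x that corresponds to the k-th clique. *)
have K k : exists z, clq x z /\ forall j, vbit z j = (j != k).
  have sk : short x != short (r (~~ c) k) by rewrite !r_short; case: (c).
  have [y cy a] := T sk; have sy := opp_clq sk cy.
  have [z [cz nz az _]] := partner Gchart sy a.
  have [l lP] := clique_edge cz nz; exists z; split=> // j.
  rewrite -[RHS]addFb -(vbit_rep c i j) -/x; suff -> : k = l by rewrite -lP addbA addbb.
  apply/eqP; rewrite -[_ == _]negbK -lP vbit_rep addFb /vbit.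
  have -> : clique_index z = i by rewrite -ix; apply/esym/clique_index_eq => //; case: cz.
  rewrite (clq_short cz) sx -/x.
  have := exchange Gchart T sy cz (clq_sym cy); rewrite a az => ->.
  by case: (adj x _).
case: b => [[] []] /=.
- by have [z [cz zP]] := K o2; exists z; rewrite !zP.
- by have [z [cz zP]] := K o1; exists z; rewrite !zP.
- by have [z [cz zP]] := K o0; exists z; rewrite !zP.
- by exists x; rewrite !vbit_rep; split=> //; apply: clq_refl.
Qed.

Lemma label_iso : bigraph_iso G (Model (fun i j => adj (r true i) (r false j))).
Proof.
exists label_of; split=> //.
  have [g gP] := choice label_of_surj; exists g => // z.
  by apply: label_of_inj; rewrite gP.
move=> x y; rewrite /= /model_adj /= !bit_label; case: eqP => [s|/eqP s].
  apply/andP/idP => [[/eqP/(clique_index_eq s) c ne]|a].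
    by apply: clq_adj c _ => E; rewrite E eqxx in ne.
  split; first exact/eqP/(clique_index_eq s)/adj_clq.
  by apply/eqP => /label_of_inj; apply: adj_neq.
rewrite (adj_vbit s) /sign_of; move: s; case: (short x); case: (short y) => //= _.
by rewrite [adj (r true _) _]adj_sym.
Qed.

End Coordinates.

(** * Normal forms *)

(** Adding to the bits of the vertices of each clique a vector of even sum is a
    relabelling; it alters the signs, not the graph. *)
Lemma model_switch (S S' : 'I_3 -> 'I_3 -> bool) (t : bool -> 'I_3 -> 'I_3 -> bool) :
  (forall c i, t c i o2 = t c i o0 (+) t c i o1) ->
  (forall i j, S' i j = S i j (+) t true i j (+) t false j i) ->
  bigraph_iso (Model S) (Model S').
Proof.
move=> teven S'E.
pose f (p : label) : label :=
  (p.1, (p.2.1 (+) t p.1.1 p.1.2 o0, p.2.2 (+) t p.1.1 p.1.2 o1)).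
have fK : involutive f by case=> [[c i] [b b']]; rewrite /f /= !addbK.
have bitf p j : bit (f p) j = bit p j (+) t p.1.1 p.1.2 j.
  by rewrite /bit; elim/I3P: j => //=; rewrite teven addbACA.
exists f; split=> [|p q|//]; first exact: inv_bij fK.
rewrite /= /model_adj (inj_eq (inv_inj fK)) !bitf /=.
case: ifP => // /negbT ne; rewrite /sign_of.
move: (bit p _) (bit q _) ne => b b'.
by case: p.1.1; case: q.1.1 => //= _; rewrite S'E;
  case: b; case: b'; case: (S _ _); case: (t true _ _); case: (t false _ _).
Qed.

Definition total_sign (S : 'I_3 -> 'I_3 -> bool) : bool :=
  let R i := S i o0 (+) S i o1 (+) S i o2 in R o0 (+) R o1 (+) R o2.

(** Switching the rows corrects the first two columns, and switching the last column
    then corrects its first two entries. The last entry is right as well because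
    switching preserves the sum of the nine signs, and nine copies of a sign sum up
    to that sign. *)
Lemma model_normal S : bigraph_iso (Model S) (Model (fun _ _ => total_sign S)).
Proof.
set s := total_sign S.
pose ext (a b : bool) (k : 'I_3) := nth false [:: a; b; a (+) b] k.
pose R i := S i o0 (+) S i o1 (+) S i o2.
pose t (c : bool) (i : 'I_3) : 'I_3 -> bool :=
  if c then ext (S i o0 (+) s) (S i o1 (+) s)
  else if i == o2 then ext (R o0 (+) s) (R o1 (+) s) else xpred0.
have sE : s = R o0 (+) R o1 (+) R o2 by [].
apply: (model_switch (t := t)) => [c i|i j].
  by rewrite /t; case: c => //; case: (i == o2).
rewrite /t {t}; move: sE; clearbody s; elim/I3P: j => /= sE.
- by rewrite addbF addKb.
- by rewrite addbF addKb.
have -> : S i o2 (+) (S i o0 (+) s (+) (S i o1 (+) s)) = R i.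
  by rewrite addbACA addbb addbF /R; case: (S i o2); case: (S i o0); case: (S i o1).
move: sE; elim/I3P: i => /=; move: (R _) (R _) (R _) => a b d -> /=;
  by case: a; case: b; case: d.
Qed.

Lemma normal_form (G : bigraph) : (forall x : G, exists n e, local_chart x n e) ->
  tight G -> inhabited G -> exists s, bigraph_iso G (Model (fun _ _ => s)).
Proof.
move=> C T [x]; have [r [rs ri ra]] := clique_reps C T x.
have [r' [rs' ri' ra']] := clique_reps C T (r o0).
pose q c i := if c == short x then r' i else r i.
have qs c i : short (q c i) = c.
  by rewrite /q; case: eqP => [->|/eqP]; rewrite ?rs' rs ?negbK //; case: c; case: (short x).
have qi c i j : clq (q c i) (q c j) -> i = j by rewrite /q; case: ifP => _; [exact: ri'|exact: ri].
have qa z : exists i, clq (q (short z) i) z.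
  rewrite /q; case: eqP => [s|/eqP s]; first by apply: ra'; rewrite rs negbK.
  by apply: ra; move: s; case: (short z); case: (short x).
eexists; apply: iso_trans (label_iso C T qs qi qa) _; exact: model_normal.
Qed.

(** * Coordinates on the Weyl graph and its twisted copy *)

(** One root of each opposite pair, in doubled coordinates. The order is that of the
    labels of the corresponding model vertices, by clique and then by bits. The
    first short clique consists of the e_k, the bits of k in binary being the first
    two bits of the label; the roots of the other two are given by the signs
    (-1)^(u.k), with u a vector of two bits, modified at k = 0 for the third clique. The
    long cliques are the three ways to split the four coordinates into two pairs,
    the first bit telling the pair and the second one the sign. *)
Definition short_reps : seq code :=
  [:: (2, 0, 0, 0); (0, 2, 0, 0); (0, 0, 2, 0); (0, 0, 0, 2);
      (1, 1, 1, 1); (1, 1, -1, -1); (1, -1, 1, -1); (1, -1, -1, 1);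
      (-1, 1, 1, 1); (-1, 1, -1, -1); (-1, -1, 1, -1); (-1, -1, -1, 1)]%Z.

Definition long_reps : seq code :=
  [:: (0, 0, 2, -2); (0, 0, 2, 2); (2, -2, 0, 0); (2, 2, 0, 0);
      (0, 2, 0, -2); (0, 2, 0, 2); (2, 0, -2, 0); (2, 0, 2, 0);
      (0, 2, -2, 0); (0, 2, 2, 0); (2, 0, 0, -2); (2, 0, 0, 2)]%Z.

Definition reps : seq code := short_reps ++ long_reps.

Definition codes : seq code := codes_short ++ codes_long.

Definition collinear (c d : code) : bool := (c == d) || (c == cneg d).

Lemma reps_codes : {subset reps <= codes}.
Proof. by apply/allP; vm_compute. Qed.

Lemma codes_reps : all (fun c => (c \in reps) || (cneg c \in reps)) codes.
Proof. by vm_compute. Qed.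

Lemma collinear_check : all (fun c => all (fun d =>
  (crefl d c == cneg c) ==> collinear c d) codes) codes.
Proof. by vm_compute. Qed.

Definition root_of (c : code) : F4_root := insubd (SeqSub (std_root i0)) (vec c).

Definition mir (c : code) : WF4 := mirror (root_of c).

Lemma root_ofE c : c \in codes -> val (root_of c) = vec c.
Proof. by move=> cC; rewrite val_insubd; case: F4_rootsP => // -[]; exists c. Qed.

Lemma root_of_code (a : F4_root) : exists2 c, c \in codes & a = root_of c.
Proof.
have /F4_rootsP[c cC E] := valP a; exists c => //.
by apply: val_inj; rewrite [RHS]root_ofE.
Qed.

Lemma crefl_code c d : c \in codes -> d \in codes -> crefl d c \in codes.
Proof. by move=> cC dC; have /allP/(_ d dC)/allP/(_ c cC)/and3P[] := codes_closed. Qed.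

Lemma refl_root_of c d : c \in codes -> d \in codes ->
  refl (root_of d) (root_of c) = root_of (crefl d c).
Proof.
move=> cC dC; have /allP/(_ d dC)/allP/(_ c cC)/and3P[d0 dv cdC] := codes_closed.
by apply: val_inj; rewrite reflE [RHS]root_ofE // !root_ofE // creflE.
Qed.

Lemma mir_adj c d : c \in codes -> d \in codes -> adj (mir c) (mir d) = (cdot c d == 0).
Proof. by move=> cC dC; rewrite [LHS]mirror_adj !root_ofE // dot_eq0. Qed.

Lemma mir_short c : c \in codes -> short (mir c) = (c \in codes_short).
Proof.
move=> cC; have [cS|cL] := boolP (c \in codes_short).
  by apply: short_mirror; rewrite root_ofE //; apply/F4_shortP; exists c.
apply/negbTE/long_mirror; rewrite root_ofE //; apply/F4_longP; exists c => //.
by move: cC; rewrite mem_cat (negbTE cL).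
Qed.

Lemma cneg_code c : c \in codes -> cneg c \in codes.
Proof. by move: c; apply/allP; vm_compute. Qed.

Lemma mir_cneg c : c \in codes -> mir (cneg c) = mir c.
Proof.
move=> cC; apply: val_inj; apply: (@refl_eq (-1)%R); first by rewrite oppr_eq0.
by rewrite !root_ofE ?cneg_code // vecN.
Qed.

Lemma mir_collinear c d : d \in codes -> collinear c d -> mir c = mir d.
Proof. by move=> dC /orP[]/eqP-> //; apply: mir_cneg. Qed.

Lemma mir_inj c d : c \in codes -> d \in codes -> mir c = mir d -> collinear c d.
Proof.
move=> cC dC /(congr1 val)/permP/(_ (root_of c))/(congr1 val).
have /allP/(_ c cC)/allP/(_ d dC)/implyP := collinear_check => H.
rewrite /= !reflE reflection_self ?root_dot_neq0 // !root_ofE //.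
have /allP/(_ d dC)/allP/(_ c cC)/and3P[d0 dv _] := codes_closed.
rewrite creflE // -scaleN1r -vecN => /vec_inj E; apply: H; exact/eqP/esym.
Qed.

Lemma mir_rep (s : WF4) : exists2 c, c \in reps & s = mir c.
Proof.
have [a ->] := mirrorP s; have [c cC ->] := root_of_code a.
have /allP/(_ c cC)/orP[cR|cR] := codes_reps; first by exists c.
by exists (cneg c) => //; rewrite mir_cneg.
Qed.

(** Long vertices come after the 12 short ones; each clique has 4 codes. *)
Definition code_of (p : label) : code :=
  nth (0, 0, 0, 0)%R reps
    (nth 0 [:: 12; 0] p.1.1 + 4 * p.1.2 + nth 0 [:: 0; 2] p.2.1 + p.2.2).

Definition labels : seq label :=
  [seq (ci, b) | ci <- [seq (c, i) | c <- bb, i <- [:: o0; o1; o2]],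
                 b <- [seq (b, b') | b <- bb, b' <- bb]].

Lemma mem_labels p : p \in labels.
Proof. by case: p => [[[] i] [[] []]]; elim/I3P: i. Qed.

Lemma label_forall (P : pred label) : all P labels -> forall p, P p.
Proof. by move/allP => H p; apply: H; apply: mem_labels. Qed.

Lemma label_forall2 (P : label -> label -> bool) :
  all (fun p => all (P p) labels) labels -> forall p q, P p q.
Proof. by move/label_forall => H p q; apply: label_forall. Qed.

Lemma code_of_code p : code_of p \in codes.
Proof. by move: p; apply: label_forall; vm_compute. Qed.

Lemma code_of_inj p q : collinear (code_of p) (code_of q) -> p = q.
Proof.
move=> c; apply/eqP; move: p q c.
move=> p q; apply/implyP; move: p q.
by apply: (label_forall2 (P := fun p q => _ ==> (p == q))); vm_compute.
Qed.

Lemma reps_code_of c : c \in reps -> exists p, c = code_of p.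
Proof.
move=> cR; have /mapP[p _ ->] : c \in [seq code_of p | p <- labels]; last by exists p.
by move: c cR; apply/allP; vm_compute.
Qed.

Lemma mir_code_of_bij : bijective (fun p => mir (code_of p)).
Proof.
have surj s : exists p, mir (code_of p) = s.
  by have [c /reps_code_of[p ->] ->] := mir_rep s; exists p.
have inj p q : mir (code_of p) = mir (code_of q) -> p = q.
  by move/(mir_inj (code_of_code p) (code_of_code q)); apply: code_of_inj.
by have [g gP] := choice surj; exists g => // p; apply: inj.
Qed.

Lemma mir_code_of_short p : short (mir (code_of p)) = p.1.1.
Proof.
rewrite mir_short ?code_of_code //; apply/eqP; move: p.
by apply: label_forall; vm_compute.
Qed.

Lemma mir_code_of_adj p q :
  adj (mir (code_of p)) (mir (code_of q)) = model_adj (fun _ _ => true) p q.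
Proof.
rewrite mir_adj ?code_of_code //; apply: (elimT eqP); move: p q.
by apply: (label_forall2 (P := fun p q => _ == model_adj _ p q)); vm_compute.
Qed.

Lemma Model_WF4 : bigraph_iso (Model (fun _ _ => true)) WF4.
Proof.
exists (fun p => mir (code_of p)); split.
- exact: mir_code_of_bij.
- exact: mir_code_of_adj.
- exact: mir_code_of_short.
Qed.

(** Twisting complements the adjacencies between the two cliques. *)
Lemma twist_adjE (G : bigraph) (x y : 'I_4 -> G) : twist_data x y ->
  forall u v, twist_adj x y u v = adj u v (+) `[< cross x y (fun _ _ => true) u v >].
Proof.
case=> xS yL xx yy _ _ xy u v.
have xinj i j : x i = x j -> i = j.
  by move=> E; apply/eqP; rewrite -[_ == _]negbK -xx E adj_irr.
have yinj i j : y i = y j -> i = j.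
  by move=> E; apply/eqP; rewrite -[_ == _]negbK -yy E adj_irr.
have xny i j : x i <> y j by move=> E; have := yL j; rewrite /long -E xS.
rewrite /twist_adj; case: (asboolP (cross x y (fun _ _ => true) u v)) => [c|nc].
  have -> : adj u v = ~~ `[< cross x y (fun i j => ~~ same_half i j) u v >].
    have [i [j [_ uv]]] := c.
    have -> : adj u v = same_half i j by case: uv => -[-> ->]; rewrite ?xy // adj_sym xy.
    rewrite -[LHS]negbK; congr negb; apply/idP/asboolP => [h|[i' [j' [h uv']]]].
      by exists i, j.
    case: uv uv' => -[-> ->] [] [].
    + by move=> /xinj-> /yinj->.
    + by move/xny.
    + by move/esym/xny.
    + by move=> /yinj-> /xinj->.
  rewrite addbT negbK; apply/asboolP/asboolP => [[//|[_ []//]]|]; by left.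
rewrite addbF; apply/asboolP/idP => [[[i [j [_ h]]]|[]//]|a].
  by case: nc; exists i, j.
by right.
Qed.

(** The cliques F4_x and F4_y used for the twist both have index 0. *)
Definition twist_block (p q : label) : bool :=
  [&& p.1.1 != q.1.1, p.1.2 == o0 & q.1.2 == o0].

Lemma F4_xE i : F4_x i = mir (code_x i).
Proof.
apply: (congr1 mirror); apply: val_inj => /=; rewrite root_ofE -?code_xE //.
by elim/I4P: i; vm_compute.
Qed.

Lemma F4_yE i : F4_y i = mir (code_y i).
Proof.
apply: (congr1 mirror); apply: val_inj => /=; rewrite root_ofE -?code_yE //.
by elim/I4P: i; vm_compute.
Qed.

Lemma clique_code_mir (f : 'I_4 -> code) p : (forall i, f i \in codes) ->
  (exists i, mir (code_of p) = mir (f i)) <-> has (fun i => collinear (code_of p) (f i)) ii.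
Proof.
move=> fC; split=> [[i /mir_inj E]|/hasP[i _ E]].
  by apply/hasP; exists i; rewrite ?mem_ii // E ?code_of_code.
by exists i; apply: mir_collinear.
Qed.

Lemma code_x_code i : code_x i \in codes. Proof. by elim/I4P: i. Qed.
Lemma code_y_code i : code_y i \in codes. Proof. by elim/I4P: i. Qed.

Lemma crossE p q :
  `[< @cross WF4 F4_x F4_y (fun _ _ => true) (mir (code_of p)) (mir (code_of q)) >] = twist_block p q.
Proof.
pose hx p := has (fun i => collinear (code_of p) (code_x i)) ii.
pose hy p := has (fun i => collinear (code_of p) (code_y i)) ii.
have -> : twist_block p q = hx p && hy q || hy p && hx q.
  apply/eqP; move: p q.
  by apply: (label_forall2 (P := fun p q => twist_block p q == _)); vm_compute.
apply/asboolP/orP => [[i [j [_ [[]|[]]]]]|[]/andP[]].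
- rewrite F4_xE F4_yE => hp hq; left; apply/andP; split.
    by apply/(clique_code_mir _ code_x_code); exists i.
  by apply/(clique_code_mir _ code_y_code); exists j.
- rewrite F4_xE F4_yE => hp hq; right; apply/andP; split.
    by apply/(clique_code_mir _ code_y_code); exists j.
  by apply/(clique_code_mir _ code_x_code); exists i.
- move=> /(clique_code_mir _ code_x_code)[i Ei] /(clique_code_mir _ code_y_code)[j Ej].
  by exists i, j; split=> //; left; rewrite F4_xE F4_yE.
- move=> /(clique_code_mir _ code_y_code)[j Ej] /(clique_code_mir _ code_x_code)[i Ei].
  by exists i, j; split=> //; right; rewrite F4_xE F4_yE.
Qed.

(** The twist changes the sign of one of the nine pairs of cliques from 1 to 0, so
    the sum becomes 0. *)
Lemma Model_WF4' : bigraph_iso (Model (fun _ _ => false)) WF4'.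
Proof.
pose S (i j : 'I_3) := ~~ ((i == o0) && (j == o0)).
apply: (iso_trans (iso_sym (model_normal S))).
exists (fun p => mir (code_of p)); split.
- exact: mir_code_of_bij.
- move=> p q; rewrite [LHS](twist_adjE WF4_twist_data) crossE mir_code_of_adj.
  rewrite /= /twist_block /model_adj; case: eqP => _ /=; first by rewrite addbF.
  by rewrite -addbA; congr addb; rewrite /sign_of /S; case: (p.1.1); rewrite 1?[(q.1.2 == _) && _]andbC.
- exact: mir_code_of_short.
Qed.

(** * Automorphisms of the Weyl graph *)

Lemma reflection_linear b k u v :
  reflection b (u - k *: v)%R = (reflection b u - k *: reflection b v)%R.
Proof.
rewrite /reflection -[(u - k *: v)%R]/(u + - (k *: v))%R -scaleNr dotDl dotZl.
by apply/rowP => i; rewrite !mxE; ring.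
Qed.

Lemma dot_reflection b u v : dot b b != 0%R -> dot (reflection b u) (reflection b v) = dot u v.
Proof.
move=> b0.
have dotr w x k y : dot w (x + k *: y)%R = (dot w x + k * dot w y)%R.
  by rewrite dotC dotDl dotZl !(dotC _ w).
by rewrite /reflection -!scaleNr dotDl dotZl !dotr (dotC b v); field.
Qed.

Lemma reflJ a b : (refl a ^ refl b)%g = refl (refl b a).
Proof.
apply/permP => v; rewrite -[v](permKV (refl b)) permJ; move: (_ v) => {}v.
apply: val_inj; rewrite !reflE; have b0 := root_dot_neq0 b.
by rewrite [RHS]/(_ - _ *: _)%R !dot_reflection //; apply: reflection_linear.
Qed.

Lemma Weyl_norm (A : {set F4_root}) : (forall a b, a \in A -> refl b a \in A) ->
  (WeylF4 \subset 'N([set refl a | a in A]%SET))%g.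
Proof.
move=> Arefl; rewrite gen_subG; apply/fintype.subsetP => _ /imsetP[b _ ->].
rewrite inE; apply/fintype.subsetP => _ /imsetP[_ /imsetP[a aA ->] ->].
by rewrite reflJ; apply/imsetP; exists (refl b a) => //; apply: Arefl.
Qed.

Definition short_roots : {set F4_root} := [set a | val a \in F4_short]%SET.

Lemma short_codes_closed :
  all (fun d => all (fun c => crefl d c \in codes_short) codes_short) codes.
Proof. by vm_compute. Qed.

Lemma short_roots_closed a b : a \in short_roots -> refl b a \in short_roots.
Proof.
have [c cC ->] := root_of_code a; have [d dC ->] := root_of_code b.
rewrite refl_root_of // !inE !root_ofE ?crefl_code // => /F4_shortP[c' c'S /vec_inj->].
by apply/F4_shortP; exists (crefl d c') => //; have /allP/(_ d dC)/allP/(_ c' c'S) := short_codes_closed.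
Qed.

Lemma F4_reflections_norm w : w \in WeylF4 -> w \in ('N(F4_reflections))%g.
Proof.
move: w; apply/fintype.subsetP; have := @Weyl_norm [set: F4_root]%SET.
suff -> : [set refl a | a in [set: F4_root]]%SET = F4_reflections.
  by apply=> a b; rewrite !inE.
by apply/setP => s; apply/imsetP/imsetP => -[a _ ->]; exists a.
Qed.

Lemma WF4_shortE (s : WF4) : short s = (val s \in [set refl a | a in short_roots]%SET).
Proof.
apply/existsP/imsetP => [[a /andP[aS /eqP E]]|[a]]; first by exists a; rewrite ?inE.
by rewrite inE => aS E; exists a; rewrite aS E eqxx.
Qed.

Lemma conj_vertex_subproof w (s : WF4) : w \in WeylF4 -> (val s ^ w^-1)%g \in F4_reflections.
Proof. by move=> wW; rewrite memJ_norm ?(valP s) // groupV F4_reflections_norm. Qed.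

(** Composition of automorphisms applies the right factor first, whence the
    inverse. *)
Lemma conj_aut_exists w : w \in WeylF4 ->
  exists f : bigraph_aut WF4, forall s, val (f s) = (val s ^ w^-1)%g.
Proof.
move=> wW; have wV : w^-1%g \in WeylF4 by rewrite groupV.
pose f (s : WF4) : WF4 := exist (fun x : {perm F4_root} => x \in F4_reflections) _ (conj_vertex_subproof s wW).
pose g (s : WF4) : WF4 := exist (fun x : {perm F4_root} => x \in F4_reflections) _ (conj_vertex_subproof s wV).
have fK : cancel f g by move=> s; apply: val_inj; rewrite /= -conjgM mulgV conjg1.
have gK : cancel g f by move=> s; apply: val_inj; rewrite /= -conjgM mulVg conjg1.
have fi : Defs.is_iso f.
  split.
  - by exists g.
  - have cE (s t : {perm F4_root}) : (s ^ w^-1 == t ^ w^-1)%g = (s == t).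
      exact: (inj_eq (@conjg_inj _ _)).
    move=> s t; congr (~~ _ && _); first exact/inj_eq/(can_inj fK).
    by rewrite /= -!conjMg; apply: cE.
  - by move=> s; rewrite !WF4_shortE /= memJ_norm // (fintype.subsetP (Weyl_norm short_roots_closed)).
by exists (Defs.Aut fi).
Qed.

(** Reflections in d whose conjugation action fixes the mirrors of all of past. *)
Definition admissible (past : seq code) : seq code :=
  [seq d <- reps | all (fun u => collinear (crefl d u) u) past].

(** One more step of the orbits under the admissible reflections; codes stand for
    roots up to sign. *)
Definition spread (past l : seq code) : seq code :=
  undup (l ++ [seq crefl d c | d <- admissible past, c <- l]).

(** What an automorphism fixing the mirrors of past must preserve: it can send the
    mirror of v to that of c only if the two have the same profile. *)
Definition same_profile (past : seq code) (c v : code) : bool :=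
  ((c \in codes_short) == (v \in codes_short)) &&
  all (fun u => ((cdot c u == 0%R) == (cdot v u == 0%R)) && (collinear c u == collinear v u)) past.

(** Having the profile of v, which is necessary for being the image of v under an
    automorphism fixing past, is sufficient: n admissible reflections lead there. *)
Definition stage (past : seq code) (v : code) (n : nat) : bool :=
  all (fun c => same_profile past c v ==> has (collinear c) (iter n (spread past) [:: v])) reps.

Fixpoint chain (past : seq code) (todo : seq (code * nat)) : bool :=
  if todo is (v, n) :: todo' then stage past v n && chain (rcons past v) todo' else true.

(** The mirrors of e_1, e_2, e_3 and of (1,1,1,1)/2 form a base of the automorphism
    group; the orbits under the successive stabilisers have 12, 3, 2 and 8 elements
    and are exhausted by 1, 1, 1 and 3 reflections. An automorphism fixing these
    four fixes every long vertex and then every short one, without any further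
    reflection; long vertices precede the short ones for that reason. *)
Definition base : seq (code * nat) :=
  [:: ((2, 0, 0, 0)%Z, 1); ((0, 2, 0, 0)%Z, 1); ((0, 0, 2, 0)%Z, 1); ((1, 1, 1, 1)%Z, 3)]
  ++ [seq (c, 0) | c <- long_reps ++ short_reps].

Lemma chain_base : chain [::] base.
Proof. by vm_compute. Qed.

Lemma conj_mir c d : c \in codes -> d \in codes ->
  (val (mir c) ^ refl (root_of d))%g = val (mir (crefl d c)).
Proof. by move=> cC dC; rewrite /= reflJ refl_root_of. Qed.

Lemma spread_orbit past v n c : {subset past <= codes} -> v \in codes ->
  c \in iter n (spread past) [:: v] -> c \in codes /\ exists h, [/\ h \in WeylF4,
    forall u, u \in past -> (val (mir u) ^ h)%g = val (mir u) &
    (val (mir v) ^ h)%g = val (mir c)].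
Proof.
move=> pC vC; elim: n c => [|n IH] c /=.
  rewrite inE => /eqP->; split=> //; exists 1%g; rewrite group1 conjg1; split=> // u _.
  by rewrite conjg1.
rewrite mem_undup mem_cat => /orP[/IH//|/allpairsP[[d c'] /= [dA c'l ->]]].
move: dA; rewrite mem_filter => /andP[/allP dP /reps_codes dC].
have [c'C [h [hW hfix hv]]] := IH c' c'l; split; first exact: crefl_code.
exists (h * refl (root_of d))%g; split.
- by rewrite groupM // mem_gen // refl_in.
- move=> u up; have uC := pC u up; rewrite conjgM hfix // conj_mir //.
  by rewrite (mir_collinear uC (dP u up)).
- by rewrite conjgM hv conj_mir.
Qed.

(** Suppose that w agrees with f on past. Then f followed by the inverse of w fixes
    past, so it sends the next vertex v to one of the same profile; by the stage at
    v, some h in the stabiliser of past does the same, and h * w agrees with f on v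
    as well. *)
Lemma aut_induced (f : bigraph_aut WF4) :
  exists2 w, w \in WeylF4 & forall s : WF4, val (f s) = (val s ^ w)%g.
Proof.
suff H todo past : {subset past <= codes} -> {subset unzip1 todo <= codes} -> chain past todo ->
    (exists2 w, w \in WeylF4 & forall u, u \in past -> val (f (mir u)) = (val (mir u) ^ w)%g) ->
    exists2 w, w \in WeylF4 &
      forall u, u \in past ++ unzip1 todo -> val (f (mir u)) = (val (mir u) ^ w)%g.
  have bC : {subset unzip1 base <= codes} by apply/allP; vm_compute.
  have [||w wW wP] := H base [::] _ bC chain_base; first by [].
    by exists 1%g.
  exists w => // s; have [c cR ->] := mir_rep s; apply: wP.
  by move: c cR; apply/allP; vm_compute.
elim: todo past => [|[v n] todo IH] past pC tC /=; first by rewrite cats0.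
move=> /andP[st ch] [w wW wP].
have vC : v \in codes by apply: tC; rewrite mem_head.
rewrite -cat_rcons; apply: IH => //.
- by move=> u; rewrite mem_rcons inE => /orP[/eqP->|/pC].
- by move=> u ut; apply: tC; rewrite inE ut orbT.
have [g gP] := conj_aut_exists wW.
have fixp u : u \in past -> g (f (mir u)) = mir u.
  by move=> up; apply: val_inj; rewrite gP [X in (X ^ _)%g]wP // -conjgM mulgV conjg1.
have [[gb ga gs] [fb fa fs]] := (aut_is_iso g, aut_is_iso f).
have [c cR cE] := mir_rep (g (f (mir v))); have cC := reps_codes cR.
have [c' c'o cc'] : exists2 c', c' \in iter n (spread past) [:: v] & collinear c c'.
  apply/hasP; have /allP/(_ c cR)/implyP := st; apply; apply/andP; split.
    by rewrite -!mir_short // -cE gs fs.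
  apply/allP => u up; have uC := pC u up; apply/andP; split.
    by rewrite -!mir_adj // -cE -{1}(fixp u up) ga fa.
  apply/eqP; apply/idP/idP => /(mir_collinear uC) E; apply: mir_inj => //.
    by move: cE; rewrite E -{1}(fixp u up) => /(bij_inj gb)/(bij_inj fb).
  by rewrite -cE E fixp.
have [c'C [h [hW hfix hv]]] := spread_orbit pC vC c'o.
exists (h * w)%g; first exact: groupM.
move=> u; rewrite mem_rcons inE => /orP[/eqP->|up]; last by rewrite conjgM hfix //; apply: wP.
by rewrite conjgM hv -(mir_collinear c'C cc') -cE gP -conjgM mulVg conjg1.
Qed.

(** An element acts trivially when it commutes with all reflections, that is, with
    the group that they generate. *)
Lemma aut_WF4 : group_isomorphic (WeylF4 / 'Z(WeylF4))%G (bigraph_aut WF4).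
Proof.
set Z := 'Z(WeylF4)%g.
have nZ : (WeylF4 \subset 'N(Z))%g by apply: gFnorm.
have /choice[lift liftP] (u : subg_of (WeylF4 / 'Z(WeylF4))%G) :
    exists w, w \in WeylF4 /\ coset Z w = sgval u.
  by have /morphimP[w wN wW E] := subgP u; exists w.
have /choice[f fP] (u : subg_of (WeylF4 / 'Z(WeylF4))%G) :
    exists f : bigraph_aut WF4, forall s, val (f s) = (val s ^ (lift u)^-1)%g.
  by apply: conj_aut_exists; have [] := liftP u.
have sameZ w w' : w \in WeylF4 -> w' \in WeylF4 ->
    (coset Z w = coset Z w') <-> (forall s : WF4, val s ^ w^-1 = val s ^ w'^-1)%g.
  move=> wW w'W; have wN := fintype.subsetP nZ _ wW; have w'N := fintype.subsetP nZ _ w'W.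
  have -> : (coset Z w = coset Z w') <-> (w^-1 * w' \in Z)%g.
    rewrite -{2}(invgK w') -mem_rcoset; split=> [E|/rcoset_kercosetP].
      by apply/rcoset_kercosetP; rewrite ?groupV // !morphV //=; congr (_^-1)%g.
    by rewrite !groupV !morphV // => /(_ wN w'N)/invg_inj.
  split=> [wZ s|H].
    move: wZ; rewrite inE cent_gen => /andP[_ /centP/(_ _ (valP s))/commute_sym].
    move=> /commgP/conjg_fixP E.
    by rewrite -[in RHS]E -conjgM mulgK.
  rewrite inE groupM ?groupV // cent_gen.
  apply/centP => x xR; apply/commute_sym/commgP/conjg_fixP.
  have := H (exist (fun x : {perm F4_root} => x \in F4_reflections) x xR).
  by rewrite conjgM => /= ->; rewrite conjgKV.
have finj : injective f.
  move=> u v E; apply: val_inj => /=; have [[uW uE] [vW vE]] := (liftP u, liftP v).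
  by rewrite -uE -vE; apply/sameZ => // s; rewrite -!fP E.
have fsurj (a : bigraph_aut WF4) : exists u, f u = a.
  have [w wW wP] := aut_induced a; have wV : w^-1%g \in WeylF4 by rewrite groupV.
  have cW : coset Z w^-1%g \in (WeylF4 / Z)%g by apply: mem_quotient.
  exists (subg _ (coset Z w^-1%g)); apply: aut_inj; apply/funext => s; apply: val_inj.
  have [uW uE] := liftP (subg _ (coset Z w^-1%g)).
  rewrite fP wP -[in RHS](invgK w); apply: (sameZ _ _ uW wV).1.
  by rewrite uE subgK.
exists f; split.
  by have [g gP] := choice fsurj; exists g => // u; apply: finj; rewrite gP.
move=> u v; apply: aut_inj; apply/funext => s; apply: val_inj; rewrite fP.
have [[uW uE] [vW vE]] := (liftP u, liftP v); have [uvW uvE] := liftP (u * v)%g.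
rewrite [RHS]fP [X in _ = (X ^ _)%g]fP -conjgM -invMg; apply: (sameZ _ _ uvW (groupM uW vW)).1.
rewrite uvE [RHS]morphM ?(fintype.subsetP nZ) // [LHS]sgvalM ?inE //.
by congr (_ * _)%g; apply: esym.
Qed.

Lemma aut_transfer (gT : finGroupType) (K : {group gT}) (G H : bigraph) :
  bigraph_iso G H -> group_isomorphic K (bigraph_aut G) -> group_isomorphic K (bigraph_aut H).
Proof.
move=> [F [[F' FK F'K] Fa Fs]] [f [fb fM]].
have iso_c (a : bigraph_aut G) : Defs.is_iso (F \o a \o F').
  have [ab aa as_] := aut_is_iso a; split.
  - by apply: bij_comp; [apply: bij_comp => //; exists F'|exists F].
  - by move=> x y; rewrite /= Fa aa -Fa !F'K.
  - by move=> x; rewrite /= Fs as_ -Fs F'K.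
have iso_d (a : bigraph_aut H) : Defs.is_iso (F' \o a \o F).
  have [ab aa as_] := aut_is_iso a; split.
  - by apply: bij_comp; [apply: bij_comp => //; exists F|exists F'].
  - by move=> x y; rewrite /= -Fa !F'K aa Fa.
  - by move=> x; rewrite /= -Fs F'K as_ Fs.
exists (fun u => Defs.Aut (iso_c (f u))); split.
  apply: (bij_comp (f := fun a => Defs.Aut (iso_c a))) fb.
  exists (fun a => Defs.Aut (iso_d a)) => a; apply: aut_inj; apply/funext => x /=.
    by rewrite !FK.
  by rewrite !F'K.
move=> u v; apply: aut_inj; apply/funext => x /=.
by rewrite fM /= FK.
Qed.

(** The two adjacencies differ exactly between vertices of different colours, and
    automorphisms preserve colours. *)
Lemma aut_model (gT : finGroupType) (K : {group gT}) s s' :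
  group_isomorphic K (bigraph_aut (Model (fun _ _ => s))) ->
  group_isomorphic K (bigraph_aut (Model (fun _ _ => s'))).
Proof.
have E t t' p q : model_adj (fun _ _ => t) p q =
    model_adj (fun _ _ => t') p q (+) ((p.1.1 != q.1.1) && (t (+) t')).
  rewrite /model_adj /sign_of !if_same; case: eqP => _ /=; first by rewrite addbF.
  by rewrite -!addbA; case: t; case: t'.
have P t t' (a : bigraph_aut (Model (fun _ _ => t))) : @Defs.is_iso (Model (fun _ _ => t')) (Model (fun _ _ => t')) a.
  have [ab aa as_] := aut_is_iso a; split=> // x y.
  have aE z : (a z).1.1 = z.1.1 := as_ z.
  by rewrite [LHS](E t' t) [RHS](E t' t) !aE; congr addb; apply: aa.
case=> f [fb fM]; exists (fun u => Defs.Aut (P s s' (f u))); split.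
  apply: (bij_comp (f := fun a => Defs.Aut (P s s' a))) fb.
  by exists (fun a => Defs.Aut (P s' s a)) => a; apply: aut_inj.
by move=> u v; apply: aut_inj; rewrite /= fM.
Qed.

(** * The classification *)

Theorem theorem16 (G : bigraph)
  (Gconn : connected G)
  (Gloc : locally_like_WF4 G)
  (Gcond : ([set: G] #= `I_24)%card
        \/ tightly_connected G
        \/ has_diameter G 2
        \/ (forall x y : G, short x = short y -> at_distance 2 x y -> mu_is x y 3)) :
  (bigraph_iso G WF4 \/ bigraph_iso G WF4') /\
  group_isomorphic (WeylF4 / 'Z(WeylF4))%G (bigraph_aut G).
Proof.
have Gchart := local_chart_exists Gloc.
have T : tight G.
  case: Gcond => [|[|[|]]].
  - exact: tight_of_card.
  - exact: tight_of_components.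
  - exact: tight_of_diameter.
  - by move=> mu3; apply: tight_of_mu.
have [s Gs] := normal_form Gchart T Gconn.1; split.
  by case: s Gs => Gs; [left|right]; apply: (iso_trans Gs);
    [exact: Model_WF4|exact: Model_WF4'].
apply: (aut_transfer (iso_sym Gs)); apply: (@aut_model _ _ true).
exact: aut_transfer (iso_sym Model_WF4) aut_WF4.
Qed.
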